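(* Every POMDP $\Gamma=(K,A,S,q,g)$ with finitely many states has a general uniform value. That is, there exists $v^*:\Delta(K)\to\mathbb R$ such that for each $\varepsilon>0$ there exist $\alpha>0$ and, for each initial probability $p\in\Delta(K)$, a behavior strategy $\sigma(p)$, with the following property: for every evaluation $\theta$ with $I(\theta)\le\alpha$ and all $p\in\Delta(K)$, - $|v_\theta(p)-v^*(p)|\le\varepsilon$, and - $\gamma_\theta(p,\sigma(p))\ge v^*(p)-\varepsilon$.
   Context: **Model.** A POMDP $\Gamma=(K,A,S,q,g)$ consists of: - a finite state set $K$, - a nonempty action set $A$, - a nonempty signal set $S$, - a transition $q:K\times A\to\Delta_f(S\times K)$, and - a payoff $g:K\times A\to[0,1]$. **Play.** Given an initial $p\in\Delta(K)$, the state $k_1$ is drawn from $p$ and not revealed. At each stage $t$, the player chooses $a_t$ and gets the unobserved payoff $g(k_t,a_t)$; then $(s_t,k_{t+1})$ is drawn from $q(k_t,a_t)$ and only $s_t$ is observed. **Strategies and values.** - A behavior strategy is $\sigma=(\sigma_t)_t$ with $\sigma_t:(A\times S)^{t-1}\to\Delta_f(A)$. - For an evaluation $\theta\in\Delta(\mathbb N^* )$, $\gamma_\theta(p,\sigma)=\mathbb E_{p,\sigma}\sum_t\theta_tg(k_t,a_t)$ and $v_\theta(p)=\sup_\sigma\gamma_\theta(p,\sigma)$. - $I(\theta)=\sum_t|\theta_{t+1}-\theta_t|$. *)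

(* Defs.v *)
From Stdlib Require Import Reals List ClassicalEpsilon.
Import ListNotations.
Open Scope R_scope.

Definition sum_list {X : Type} (f : X -> R) (l : list X) : R :=
  fold_right (fun x acc => f x + acc) 0 l.

(* A finitely supported probability on X, given as a weighted list
   (duplicates allowed: the mass of x is the total weight of its copies). *)
Definition is_fdist {X : Type} (l : list (X * R)) : Prop :=
  Forall (fun xw => 0 <= snd xw) l /\ sum_list snd l = 1.

(* Delta(K) for a finite type K enumerated (without repetition) by enumK *)
Definition is_prob {K : Type} (enumK : list K) (p : K -> R) : Prop :=
  (forall k, 0 <= p k) /\ sum_list p enumK = 1.

Definition series_value (s : nat -> R) : R :=
  epsilon (inhabits 0) (fun l => infinite_sum s l).

Definition sup_R (E : R -> Prop) : R :=
  epsilon (inhabits 0) (fun l => is_lub E l).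

(* Evaluations theta in Delta(N-star): stage t >= 1 gets weight theta (t-1). *)
Definition is_evaluation (theta : nat -> R) : Prop :=
  (forall n, 0 <= theta n) /\ infinite_sum theta 1.

Definition I_eval (theta : nat -> R) : R :=
  series_value (fun n => Rabs (theta (S n) - theta n)).

Section POMDP.
Variables (K A Sig : Type).

(* behavior strategy: history in (A x S)^(t-1) -> finitely supported law on A *)
Definition strategy := list (A * Sig) -> list (A * R).

Definition is_strategy (sigma : strategy) : Prop :=
  forall h, is_fdist (sigma h).

Variables (enumK : list K) (q : K -> A -> list ((Sig * K) * R))
          (g : K -> A -> R).

(* layer p sigma n : weighted list of (history of length n, current state
   k_{n+1}) describing the joint law of (h_{n+1}, k_{n+1}) under P_{p,sigma}. *)
Fixpoint layer (p : K -> R) (sigma : strategy) (n : nat)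
  : list ((list (A * Sig) * K) * R) :=
  match n with
  | O => map (fun k => (([] : list (A * Sig)), k, p k)) enumK
  | S m =>
      flat_map (fun hkw =>
        let '(h, k, w) := hkw in
        flat_map (fun aw =>
          let '(a, wa) := aw in
          map (fun skw =>
            let '((s, k'), wq) := skw in
            (h ++ [(a, s)], k', w * wa * wq)) (q k a)) (sigma h))
        (layer p sigma m)
  end.

(* E_{p,sigma}[ g(k_t, a_t) ] for stage t = n+1 *)
Definition stage_payoff (p : K -> R) (sigma : strategy) (n : nat) : R :=
  sum_list (fun hkw =>
    let '(h, k, w) := hkw in
    w * sum_list (fun aw => let '(a, wa) := aw in wa * g k a) (sigma h))
    (layer p sigma n).

Definition gamma (theta : nat -> R) (p : K -> R) (sigma : strategy) : R :=
  series_value (fun n => theta n * stage_payoff p sigma n).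

Definition v_theta (theta : nat -> R) (p : K -> R) : R :=
  sup_R (fun x => exists sigma, is_strategy sigma /\ x = gamma theta p sigma).

End POMDP.

(* Main.v *)
Require Import Defs.
From Stdlib Require Import Reals List Lra Lia Psatz.
From Stdlib Require Import Classical ClassicalEpsilon FunctionalExtensionality.
Import ListNotations.
Open Scope R_scope.

(** The evaluations with small variation I(theta) are close to mixtures of uniform
    evaluations over windows of a fixed length n.  Let v(p) be the infimum over n of
    the largest mean payoff that can be obtained over a window of length n, wherever
    it starts: this bounds v_theta(p) from above.

    Conversely, for every n pick a window and a strategy with mean payoff about v(p),
    and let E_n be the law of (t, h_t, k_t) for t uniform on the window.  One more
    stage of the strategy changes E_n by at most 1/n.  The beliefs live in a compact
    simplex, so along a subsequence a player facing E_n can imitate, by a random choice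
    of the index, a player facing the next E_n', up to a summable error.  Imitation
    is causal, so infinitely many of them compose: after one stage in one window the
    player moves on to the next window, and every stage pays about v(p).  From p, this
    regime is entered after a random time, uniform on the first window, which costs
    O(I(theta)). *)

(** A limit of the laws E_n would be stationary, but there need be no limit strategy to play with
    it: actions and signals may be infinite in number, so strategies have no compactness. Beliefs on
    the finite set of states do. So no limit law is formed: each block is compared with another
    actual block.

    Imitation works because the payoff of a continuation is linear in the belief. With beliefs
    rounded to a finite net, two blocks that give nearly equal mass to every cell are exchangeable:
    a player whose belief is in some cell pretends to hold an index drawn from the same cell of the
    other block. The cell masses form a point of a cube of fixed dimension, so infinitely many n can
    be kept with all pairs close, and nested choices give errors of order eps 2^-i. Errors must be
    summable because stage t+1 is reached through t imitations, with no bound on t. *)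

Lemma Rabs_le_inv x b : Rabs x <= b -> - b <= x <= b.
Proof.
  pose proof (Rle_abs x); pose proof (Rle_abs (- x)); rewrite Rabs_Ropp in *; lra.
Qed.

(** * Finite sums and expectations *)

Lemma sum_list_app {X} (f : X -> R) l1 l2 :
  sum_list f (l1 ++ l2) = sum_list f l1 + sum_list f l2.
Proof. induction l1 as [|x l1 IH]; simpl; [lra|]. rewrite IH; lra. Qed.

Lemma sum_list_map {X Y} (f : Y -> R) (h : X -> Y) l :
  sum_list f (map h l) = sum_list (fun x => f (h x)) l.
Proof. induction l as [|x l IH]; simpl; [lra|]. rewrite IH; lra. Qed.

Lemma sum_list_flat_map {X Y} (f : Y -> R) (h : X -> list Y) l :
  sum_list f (flat_map h l) = sum_list (fun x => sum_list f (h x)) l.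
Proof.
  induction l as [|x l IH]; simpl; [lra|]. rewrite sum_list_app, IH; lra.
Qed.

Lemma sum_list_ext_in {X} (f f' : X -> R) l :
  (forall x, In x l -> f x = f' x) -> sum_list f l = sum_list f' l.
Proof.
  induction l as [|x l IH]; simpl; intros H; [lra|].
  rewrite (H x), IH; auto.
Qed.

Lemma sum_list_ext {X} (f f' : X -> R) l :
  (forall x, f x = f' x) -> sum_list f l = sum_list f' l.
Proof. intros H; apply sum_list_ext_in; auto. Qed.

Lemma sum_list_plus {X} (f f' : X -> R) l :
  sum_list (fun x => f x + f' x) l = sum_list f l + sum_list f' l.
Proof. induction l as [|x l IH]; simpl; [lra|]. rewrite IH; lra. Qed.

Lemma sum_list_scal {X} c (f : X -> R) l :
  sum_list (fun x => c * f x) l = c * sum_list f l.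
Proof. induction l as [|x l IH]; simpl; [lra|]. rewrite IH; lra. Qed.

Lemma sum_list_scal_r {X} c (f : X -> R) l :
  sum_list (fun x => f x * c) l = sum_list f l * c.
Proof. induction l as [|x l IH]; simpl; [lra|]. rewrite IH; lra. Qed.

Lemma sum_list_minus {X} (f f' : X -> R) l :
  sum_list (fun x => f x - f' x) l = sum_list f l - sum_list f' l.
Proof. induction l as [|x l IH]; simpl; [lra|]. rewrite IH; lra. Qed.

Lemma sum_list_const {X} c (l : list X) :
  sum_list (fun _ => c) l = INR (length l) * c.
Proof.
  induction l as [|x l IH]; [simpl; lra|].
  change (length (x :: l)) with (S (length l)).
  rewrite S_INR; simpl sum_list; rewrite IH; lra.
Qed.

Lemma sum_list_swap {X Y} (f : X -> Y -> R) l l' :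
  sum_list (fun x => sum_list (f x) l') l =
  sum_list (fun y => sum_list (fun x => f x y) l) l'.
Proof.
  induction l as [|x l IH]; simpl.
  - symmetry; rewrite sum_list_const; lra.
  - rewrite IH, <- sum_list_plus; auto.
Qed.

Lemma sum_list_le_in {X} (f f' : X -> R) l :
  (forall x, In x l -> f x <= f' x) -> sum_list f l <= sum_list f' l.
Proof.
  induction l as [|x l IH]; simpl; intros H; [lra|].
  apply Rplus_le_compat; auto.
Qed.

Lemma sum_list_nonneg {X} (f : X -> R) l :
  (forall x, In x l -> 0 <= f x) -> 0 <= sum_list f l.
Proof.
  intros H; replace 0 with (sum_list (fun _ : X => 0) l).
  - now apply sum_list_le_in.
  - rewrite sum_list_const; lra.
Qed.

Lemma sum_list_term_le {X} (f : X -> R) l y :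
  (forall x, In x l -> 0 <= f x) -> In y l -> f y <= sum_list f l.
Proof.
  induction l as [|x l IH]; simpl; intros H Hy; [tauto|].
  pose proof (H x (or_introl eq_refl)).
  assert (0 <= sum_list f l) by (apply sum_list_nonneg; auto).
  destruct Hy as [->|Hy]; [lra|].
  specialize (IH (fun x' h => H x' (or_intror h)) Hy); lra.
Qed.

Lemma sum_list_abs_le {X} (f : X -> R) l :
  Rabs (sum_list f l) <= sum_list (fun x => Rabs (f x)) l.
Proof.
  induction l as [|x l IH]; simpl; [rewrite Rabs_R0; lra|].
  eapply Rle_trans; [apply Rabs_triang|lra].
Qed.

Definition indic (P : Prop) : R := if excluded_middle_informative P then 1 else 0.

Lemma indic_true (P : Prop) : P -> indic P = 1.
Proof. unfold indic; destruct excluded_middle_informative; tauto. Qed.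

Lemma indic_false (P : Prop) : ~ P -> indic P = 0.
Proof. unfold indic; destruct excluded_middle_informative; tauto. Qed.

Lemma indic_bounds (P : Prop) : 0 <= indic P <= 1.
Proof. unfold indic; destruct excluded_middle_informative; lra. Qed.

Lemma sum_list_indic_notin {X} (y : X) (f : X -> R) l :
  ~ In y l -> sum_list (fun x => indic (y = x) * f x) l = 0.
Proof.
  induction l as [|x l IH]; simpl; intros H; [lra|].
  assert (y <> x) by (intros ->; tauto).
  rewrite IH, indic_false by tauto; lra.
Qed.

Lemma sum_list_indic {X} (y : X) (f : X -> R) l :
  NoDup l -> In y l -> sum_list (fun x => indic (y = x) * f x) l = f y.
Proof.
  induction 1 as [|x l Hx Hl IH]; simpl; intros H; [tauto|].
  destruct (classic (y = x)) as [<-|E].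
  - rewrite indic_true, sum_list_indic_notin by auto; lra.
  - rewrite indic_false, IH by (auto; destruct H; congruence); lra.
Qed.

Definition expect {X} (l : list (X * R)) (F : X -> R) : R :=
  sum_list (fun xw => snd xw * F (fst xw)) l.

Lemma expect_ext_in {X} (l : list (X * R)) F F' :
  (forall xw, In xw l -> F (fst xw) = F' (fst xw)) -> expect l F = expect l F'.
Proof. intros H; apply sum_list_ext_in; intros x Hx; rewrite H; auto. Qed.

Lemma expect_ext {X} (l : list (X * R)) F F' :
  (forall x, F x = F' x) -> expect l F = expect l F'.
Proof. intros H; apply expect_ext_in; auto. Qed.

Lemma expect_flat_map {X Y} (F : Y -> R) (h : X -> list (Y * R)) l :
  expect (flat_map h l) F = sum_list (fun x => expect (h x) F) l.
Proof. apply sum_list_flat_map. Qed.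

Lemma expect_scal {X} c (l : list (X * R)) F :
  expect l (fun x => c * F x) = c * expect l F.
Proof.
  unfold expect; rewrite <- sum_list_scal; apply sum_list_ext; intros; ring.
Qed.

Lemma expect_sum {X Y} (l : list (X * R)) (F : Y -> X -> R) J :
  expect l (fun x => sum_list (fun i => F i x) J)
  = sum_list (fun i => expect l (F i)) J.
Proof.
  unfold expect; rewrite <- sum_list_swap; apply sum_list_ext; intros x.
  now rewrite sum_list_scal.
Qed.

Lemma fdist_nonneg {X} (l : list (X * R)) xw :
  is_fdist l -> In xw l -> 0 <= snd xw.
Proof. intros [H _]; rewrite Forall_forall in H; auto. Qed.

Lemma fdist_intro {X} (l : list (X * R)) :
  (forall xw, In xw l -> 0 <= snd xw) -> expect l (fun _ => 1) = 1 -> is_fdist l.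
Proof.
  intros H1 H2; split; [now apply Forall_forall|].
  rewrite <- H2; apply sum_list_ext; intros; ring.
Qed.

Lemma expect_const {X} (l : list (X * R)) c :
  is_fdist l -> expect l (fun _ => c) = c.
Proof.
  intros [_ H]; unfold expect; rewrite sum_list_scal_r.
  rewrite H; ring.
Qed.

Lemma expect_le {X} (l : list (X * R)) F F' :
  is_fdist l -> (forall x, F x <= F' x) -> expect l F <= expect l F'.
Proof.
  intros Hl H; apply sum_list_le_in; intros x Hx.
  apply Rmult_le_compat_l; auto. now apply fdist_nonneg with l.
Qed.

Lemma expect_bounds {X} (l : list (X * R)) F a b :
  is_fdist l -> (forall x, a <= F x <= b) -> a <= expect l F <= b.
Proof.
  intros Hl H; split.
  - rewrite <- (expect_const l a Hl); apply expect_le; auto; apply H.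
  - rewrite <- (expect_const l b Hl); apply expect_le; auto; apply H.
Qed.

Lemma expect_partition {X Y} (E : list (X * R)) (pi : X -> Y) D F :
  NoDup D -> (forall xw, In xw E -> In (pi (fst xw)) D) ->
  expect E F = sum_list (fun y => expect E (fun x => indic (pi x = y) * F x)) D.
Proof.
  intros HD H; rewrite <- expect_sum; apply expect_ext_in; intros xw Hx.
  now rewrite (sum_list_indic (pi (fst xw)) (fun _ => F (fst xw))) by auto.
Qed.

Definition eq_dec_classic {X} (x y : X) : {x = y} + {x <> y} :=
  excluded_middle_informative (x = y).

(** * Partial sums *)

Definition psum (f : nat -> R) (n : nat) : R := sum_list f (seq 0 n).

Lemma psum_S f n : psum f (S n) = psum f n + f n.
Proof.
  unfold psum; rewrite seq_S, sum_list_app; simpl; lra.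
Qed.

Lemma sum_f_R0_psum f n : sum_f_R0 f n = psum f (S n).
Proof.
  induction n as [|n IH]; [unfold psum; simpl; lra|].
  rewrite psum_S, <- IH; reflexivity.
Qed.

Lemma psum_le f f' n : (forall i, f i <= f' i) -> psum f n <= psum f' n.
Proof. intros H; apply sum_list_le_in; auto. Qed.

Lemma psum_growing f n m :
  (forall i, 0 <= f i) -> (n <= m)%nat -> psum f n <= psum f m.
Proof.
  intros Hf; induction 1 as [|m _ IH]; [lra|].
  rewrite psum_S; specialize (Hf m); lra.
Qed.

Lemma psum_split f t J :
  psum f (t + J) = psum f t + psum (fun j => f (t + j)%nat) J.
Proof.
  induction J as [|J IH].
  - rewrite Nat.add_0_r; unfold psum at 3; simpl; lra.
  - rewrite Nat.add_succ_r, !psum_S, IH; lra.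
Qed.

Lemma sum_list_seq_shift f j o n :
  sum_list (fun t => f (t + j)%nat) (seq o n) = sum_list f (seq (o + j) n).
Proof.
  revert o; induction n as [|n IH]; intros o; simpl; [reflexivity|].
  now rewrite (IH (S o)).
Qed.

(** [series_value] is an epsilon choice and means something only once convergence is known; for
    nonnegative terms, bounded partial sums supply it. *)
Lemma infinite_sum_nonneg f B :
  (forall i, 0 <= f i) -> (forall n, psum f n <= B) ->
  (forall n, psum f n <= series_value f) /\ series_value f <= B /\
  infinite_sum f (series_value f).
Proof.
  intros Hf HB.
  assert (Hg : Un_growing (fun n => sum_f_R0 f n)).
  { intros n; rewrite !sum_f_R0_psum; apply psum_growing; auto. }
  assert (Hex : exists l, infinite_sum f l).
  { destruct (growing_cv (fun n => sum_f_R0 f n)) as [l Hl]; auto.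
    - exists B; intros x [n ->]; rewrite sum_f_R0_psum; auto.
    - now exists l. }
  assert (Hs : infinite_sum f (series_value f)).
  { unfold series_value; apply epsilon_spec; exact Hex. }
  split; [|split]; auto.
  - intros n. apply Rle_trans with (psum f (S n)); [apply psum_growing; auto|].
    rewrite <- sum_f_R0_psum.
    apply (growing_ineq (fun n => sum_f_R0 f n)); auto.
  - apply Rnot_lt_le; intros Hlt.
    destruct (Hs (series_value f - B)) as [N HN]; [lra|].
    specialize (HN N (le_n N)); unfold Rdist in HN; apply Rabs_def2 in HN.
    rewrite sum_f_R0_psum in HN; specialize (HB (S N)); lra.
Qed.

(** * Evaluations of small variation *)

Section Evaluation.
Variable theta : nat -> R.
Hypothesis Htheta : is_evaluation theta.

Lemma evaluation_psum_le n : psum theta n <= 1.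
Proof.
  destruct Htheta as [H0 H1].
  apply Rle_trans with (psum theta (S n)); [apply psum_growing; auto|].
  rewrite <- sum_f_R0_psum.
  apply (growing_ineq (fun n => sum_f_R0 theta n)); auto.
  intros m; rewrite !sum_f_R0_psum; apply psum_growing; auto.
Qed.

Lemma evaluation_psum_cv eps : 0 < eps -> exists n, 1 - eps < psum theta n.
Proof.
  intros He; destruct Htheta as [_ H1]; destruct (H1 eps He) as [N HN].
  exists (S N); specialize (HN N (le_n N)); unfold Rdist in HN.
  rewrite sum_f_R0_psum in HN; apply Rabs_def2 in HN; lra.
Qed.

Lemma psum_variation_le n :
  psum (fun i => Rabs (theta (S i) - theta i)) n <= I_eval theta.
Proof.
  destruct Htheta as [H0 _].
  (* Each increment is at most the sum of its two weights, so the total variation is at most twice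
     the total mass. *)
  apply (infinite_sum_nonneg _ 2).
  - intros; apply Rabs_pos.
  - intros m.
    apply Rle_trans with (psum (fun i => theta (S i) + theta i) m).
    + apply psum_le; intros i; apply Rabs_le; pose proof (H0 i); pose proof (H0 (S i)); lra.
    + unfold psum; rewrite sum_list_plus; fold (psum theta m).
      pose proof (evaluation_psum_le m).
      pose proof (evaluation_psum_le (1 + m)) as H2.
      rewrite psum_split in H2; unfold psum in H2 at 1; simpl in H2.
      pose proof (H0 O); unfold psum in *; simpl in *; lra.
Qed.

Lemma I_eval_nonneg : 0 <= I_eval theta.
Proof. pose proof (psum_variation_le 0) as H; unfold psum in H; simpl in H; lra. Qed.

Lemma evaluation_diff_le s t : theta s - theta (s + t)%nat <= I_eval theta.
Proof.
  apply Rle_trans with (psum (fun i => Rabs (theta (S i) - theta i)) (s + t)); [|apply psum_variation_le].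
  rewrite psum_split.
  assert (0 <= psum (fun i => Rabs (theta (S i) - theta i)) s)
    by (apply sum_list_nonneg; intros; apply Rabs_pos).
  assert (theta s - theta (s + t)%nat <=
    psum (fun j => Rabs (theta (S (s + j)) - theta (s + j)%nat)) t); [|lra].
  induction t as [|t IH].
  - rewrite Nat.add_0_r; unfold psum; simpl; lra.
  - rewrite psum_S, Nat.add_succ_r.
    pose proof (Rle_abs (-(theta (S (s + t)) - theta (s + t)%nat))).
    rewrite Rabs_Ropp in *; lra.
Qed.

(** From a weight above the variation, [theta] could never come down to 0: all later weights would
    exceed a fixed positive number, against total mass 1. *)
Lemma evaluation_le_I_eval s : theta s <= I_eval theta.
Proof.
  apply Rnot_lt_le; intros Hlt.
  assert (Hlow : forall J, INR J * (theta s - I_eval theta) <= 1).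
  { intros J.
    apply Rle_trans with (psum theta (s + J)); [|apply evaluation_psum_le].
    rewrite psum_split.
    assert (0 <= psum theta s) by (apply sum_list_nonneg; intros; apply Htheta).
    assert (INR J * (theta s - I_eval theta) <= psum (fun j => theta (s + j)%nat) J); [|lra].
    replace (INR J * (theta s - I_eval theta))
      with (psum (fun _ => theta s - I_eval theta) J)
      by (unfold psum; rewrite sum_list_const, length_seq; reflexivity).
    apply psum_le; intros j; pose proof (evaluation_diff_le s j); lra. }
  destruct (INR_unbounded (/ (theta s - I_eval theta))) as [J HJ].
  specialize (Hlow J).
  assert (1 < INR J * (theta s - I_eval theta)); [|lra].
  apply Rmult_lt_reg_r with (/ (theta s - I_eval theta)).
  - apply Rinv_0_lt_compat; lra.
  - rewrite Rmult_assoc, Rinv_r by lra; lra.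
Qed.

(** A shift by t is made of t unit shifts, and each of them costs at most the total variation. *)
Lemma psum_shift_le t J :
  psum (fun j => Rabs (theta (t + j)%nat - theta j)) J <= INR t * I_eval theta.
Proof.
  induction t as [|t IH].
  - simpl INR. replace (psum _ J) with (psum (fun _ => 0) J).
    + unfold psum; rewrite sum_list_const; lra.
    + apply sum_list_ext; intros j; simpl.
      rewrite Rminus_diag, Rabs_R0; reflexivity.
  - rewrite S_INR.
    apply Rle_trans with
      (psum (fun j => Rabs (theta (S (t + j)) - theta (t + j)%nat)
                      + Rabs (theta (t + j)%nat - theta j)) J).
    + apply psum_le; intros j; simpl.
      replace (theta (S (t + j)) - theta j)
        with ((theta (S (t + j)) - theta (t + j)%nat) + (theta (t + j)%nat - theta j)) by ring.
      apply Rabs_triang.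
    + unfold psum at 1; rewrite sum_list_plus.
      fold (psum (fun j => Rabs (theta (t + j)%nat - theta j)) J).
      fold (psum (fun j => Rabs (theta (S (t + j)) - theta (t + j)%nat)) J).
      pose proof (psum_variation_le (t + J)) as H.
      rewrite psum_split in H.
      assert (0 <= psum (fun i => Rabs (theta (S i) - theta i)) t)
        by (apply sum_list_nonneg; intros; apply Rabs_pos).
      lra.
Qed.

Lemma psum_shift_eval_le (x : nat -> R) t J :
  (forall i, 0 <= x i <= 1) ->
  Rabs (psum (fun j => theta (t + j)%nat * x j) J - psum (fun j => theta j * x j) J)
  <= INR t * I_eval theta.
Proof.
  intros Hx; eapply Rle_trans; [|apply (psum_shift_le t J)].
  unfold psum; rewrite <- sum_list_minus.
  eapply Rle_trans; [apply sum_list_abs_le|].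
  apply sum_list_le_in; intros j _.
  replace (theta (t + j)%nat * x j - theta j * x j)
    with ((theta (t + j)%nat - theta j) * x j) by ring.
  rewrite Rabs_mult, (Rabs_pos_eq (x j)) by apply Hx.
  pose proof (Rabs_pos (theta (t + j)%nat - theta j)); specialize (Hx j); nra.
Qed.

Lemma psum_head_le (x : nat -> R) t :
  (forall i, 0 <= x i <= 1) ->
  psum (fun j => theta j * x j) t <= INR t * I_eval theta.
Proof.
  intros Hx.
  replace (INR t * I_eval theta) with (psum (fun _ => I_eval theta) t)
    by (unfold psum; rewrite sum_list_const, length_seq; reflexivity).
  apply psum_le; intros i; pose proof (evaluation_le_I_eval i).
  destruct Htheta as [H0 _]; specialize (H0 i); specialize (Hx i); nra.
Qed.

(* Every shift by t < n changes the evaluated payoff by at most 2 t I(theta);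
   averaging over t replaces each stage payoff by the mean over a window of
   length n. *)
Lemma eval_le_window (x : nat -> R) n h J :
  (forall i, 0 <= x i <= 1) -> (0 < n)%nat ->
  (forall m, sum_list x (seq m n) <= INR n * h) ->
  psum (fun j => theta j * x j) J <= h + 2 * INR n * I_eval theta.
Proof.
  intros Hx Hn Hw.
  pose proof I_eval_nonneg as HI.
  assert (Hn' : 0 < INR n) by (now apply lt_0_INR).
  (* The sign of h matters at the end, where the partial mass of [theta] is only known to be at most
     1. *)
  assert (Hh : 0 <= h).
  { specialize (Hw O).
    assert (0 <= sum_list x (seq 0 n)) by (apply sum_list_nonneg; intros; apply Hx).
    apply Rmult_le_reg_l with (INR n); lra. }
  set (S0 := psum (fun j => theta j * x j) J).
  assert (Hs : forall t, (t < n)%nat ->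
     S0 <= psum (fun j => theta j * x (t + j)%nat) J + 2 * INR n * I_eval theta).
  { intros t Ht.
    assert (S0 <= psum (fun j => theta j * x j) (t + J)).
    { apply psum_growing; [|lia]. intros i; apply Rmult_le_pos; [apply Htheta|apply Hx]. }
    rewrite psum_split in H.
    pose proof (psum_head_le x t Hx).
    pose proof (psum_shift_eval_le (fun j => x (t + j)%nat) t J (fun i => Hx _)) as H2.
    apply Rabs_le_inv in H2; cbv beta in H2.
    assert (INR t * I_eval theta <= INR n * I_eval theta).
    { apply Rmult_le_compat_r; auto. apply le_INR; lia. }
    lra. }
  assert (Hsum : INR n * S0 <= INR n * (h + 2 * INR n * I_eval theta)).
  { replace (INR n * S0) with (sum_list (fun _ => S0) (seq 0 n))
      by (rewrite sum_list_const, length_seq; reflexivity).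
    apply Rle_trans with
      (sum_list (fun t => psum (fun j => theta j * x (t + j)%nat) J
                          + 2 * INR n * I_eval theta) (seq 0 n)).
    { apply sum_list_le_in; intros t Ht; apply in_seq in Ht; apply Hs; lia. }
    rewrite sum_list_plus, sum_list_const, length_seq.
    unfold psum; rewrite sum_list_swap.
    assert (sum_list (fun y => sum_list (fun t => theta y * x (t + y)%nat) (seq 0 n)) (seq 0 J)
            <= psum (fun j => theta j * (INR n * h)) J).
    { apply sum_list_le_in; intros j _; rewrite sum_list_scal.
      apply Rmult_le_compat_l; [apply Htheta|].
      eapply Rle_trans; [|apply (Hw j)]; apply Req_le.
      apply (sum_list_seq_shift x j 0). }
    unfold psum in H; rewrite sum_list_scal_r in H.
    fold (psum theta J) in H; pose proof (evaluation_psum_le J).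
    assert (0 <= INR n * h) by nra.
    nra. }
  apply Rmult_le_reg_l with (INR n); lra.
Qed.

End Evaluation.

(** * Total boundedness *)

Lemma unit_grid delta :
  0 < delta ->
  exists l : list R, (forall r, In r l -> 0 <= r <= 1) /\
    forall x, 0 <= x <= 1 -> exists r, In r l /\ Rabs (x - r) <= delta.
Proof.
  intros Hd.
  assert (H : forall n, exists l : list R, (forall r, In r l -> 0 <= r <= 1) /\
    forall x, 0 <= x <= 1 -> x <= INR n * delta ->
    exists r, In r l /\ Rabs (x - r) <= delta).
  { induction n as [|n [l [Hl IH]]].
    - exists [0]; split; [simpl; intros r [<-|[]]; lra|].
      simpl; intros x Hx Hx'; exists 0; split; auto; apply Rabs_le; lra.
    - exists (Rmin 1 (INR n * delta) :: l); split.
      + intros r [<-|Hr]; auto. pose proof (pos_INR n).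
        unfold Rmin; destruct Rle_dec; nra.
      + intros x Hx Hx'; rewrite S_INR in Hx'.
        destruct (Rle_dec x (INR n * delta)) as [Hle|Hgt].
        * destruct (IH x Hx Hle) as [r [Hr1 Hr2]]; exists r; simpl; auto.
        * exists (Rmin 1 (INR n * delta)); split; [simpl; auto|].
          rewrite Rmin_right by lra; apply Rabs_le; lra. }
  destruct (INR_unbounded (/ delta)) as [n Hn].
  destruct (H n) as [l [Hl1 Hl2]]; exists l; split; auto.
  intros x Hx; apply Hl2; auto.
  apply Rmult_lt_compat_r with (r := delta) in Hn; auto.
  rewrite Rinv_l in Hn; lra.
Qed.

Lemma cube_net {K} delta (l : list K) :
  0 < delta ->
  exists Rs : list (K -> R), (forall r, In r Rs -> forall k, 0 <= r k <= 1) /\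
    forall x, (forall k, 0 <= x k <= 1) ->
      exists r, In r Rs /\ forall k, In k l -> Rabs (x k - r k) <= delta.
Proof.
  intros Hd; destruct (unit_grid delta Hd) as [G [HG1 HG2]].
  induction l as [|k l [Rs [H1 H2]]].
  - exists [fun _ => 0]; split.
    + intros r [<-|[]] k; lra.
    + intros x _; exists (fun _ => 0); simpl; tauto.
  - exists (flat_map (fun r => map (fun v k' => if eq_dec_classic k' k then v else r k') G) Rs).
    split.
    + intros r Hr k'; apply in_flat_map in Hr as [r0 [Hr0 Hr]].
      apply in_map_iff in Hr as [v [<- Hv]]; destruct eq_dec_classic; auto.
    + intros x Hx; destruct (H2 x Hx) as [r [Hr Hxr]].
      destruct (HG2 (x k) (Hx k)) as [v [Hv Hxv]].
      exists (fun k' => if eq_dec_classic k' k then v else r k'); split.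
      * apply in_flat_map; exists r; split; auto. apply in_map_iff; eauto.
      * intros k' Hk'; destruct eq_dec_classic as [->|E]; auto.
        apply Hxr; destruct Hk'; congruence.
Qed.

(** * Rounding of beliefs and imitation between laws *)

Section Quantization.
Context {K J : Type}.
Variable enumK : list K.
Hypotheses (HKnodup : NoDup enumK) (HKall : forall k, In k enumK).
Variables (delta : R) (Rs : list (K -> R)) (r0 : K -> R).
Hypothesis Hnet : forall x, (forall k, 0 <= x k <= 1) ->
  exists r, In r Rs /\ forall k, In k enumK -> Rabs (x k - r k) <= delta.

Let cell (l : nat) : K -> R := nth l Rs r0.

(* [kappa j] is the net point next to the conditional law of [k] given [j]. *)
Lemma quantize (E : list ((J * K) * R)) :
  is_fdist E ->
  exists kappa : J -> nat, (forall j, (kappa j < length Rs)%nat) /\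
    forall f : J -> K -> R, (forall j k, 0 <= f j k <= 1) ->
    Rabs (expect E (fun jk => f (fst jk) (snd jk))
          - expect E (fun jk => sum_list (fun k => cell (kappa (fst jk)) k * f (fst jk) k) enumK))
    <= INR (length enumK) * delta.
Proof.
  intros HE.
  set (mu := fun j k => expect E (fun jk => indic (fst jk = j) * indic (snd jk = k))).
  set (M := fun j => expect E (fun jk => indic (fst jk = j))).
  assert (Hmu : forall j k, 0 <= mu j k <= M j).
  { intros j k; split.
    - apply sum_list_nonneg; intros x Hx; apply Rmult_le_pos.
      + now apply fdist_nonneg with E.
      + apply Rmult_le_pos; apply indic_bounds.
    - apply expect_le; auto; intros x.
      pose proof (indic_bounds (fst x = j)); pose proof (indic_bounds (snd x = k)); nra. }
  assert (Hk : forall j, exists l, (l < length Rs)%nat /\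
    forall k, Rabs (mu j k - M j * cell l k) <= M j * delta).
  (* Multiplying the conditional law by [M j] makes the estimate meaningful for an index of mass 0,
     where cell 0 serves; the net applied to the zero vector shows that [Rs] is not empty. *)
  { intros j; destruct (Req_dec (M j) 0) as [HM|HM].
    - destruct (Hnet (fun _ => 0)) as [r [Hr _]]; [intros; lra|].
      exists O; split; [destruct Rs; simpl in *; [tauto|lia]|].
      intros k; pose proof (Hmu j k); rewrite HM in *.
      replace (mu j k - 0 * cell 0 k) with 0 by lra; rewrite Rabs_R0; lra.
    - assert (HM0 : 0 < M j).
      { assert (0 <= M j); [|lra].
        apply expect_bounds with (b := 1); auto; intros; apply indic_bounds. }
      destruct (Hnet (fun k => mu j k / M j)) as [r [Hr Hxr]].
      { intros k; pose proof (Hmu j k); split.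
        - apply Rmult_le_pos; [lra|]. left; now apply Rinv_0_lt_compat.
        - apply Rmult_le_reg_r with (M j); auto. unfold Rdiv.
          rewrite Rmult_assoc, Rinv_l; lra. }
      destruct (In_nth Rs r r0 Hr) as [l [Hl Hlr]].
      exists l; split; auto; intros k; unfold cell; rewrite Hlr.
      replace (mu j k - M j * r k) with (M j * (mu j k / M j - r k)) by (field; lra).
      rewrite Rabs_mult, (Rabs_pos_eq (M j)) by lra.
      apply Rmult_le_compat_l; auto; lra. }
  destruct (choice _ Hk) as [kappa Hkappa]; exists kappa; split; [intros; apply Hkappa|].
  intros f Hf.
  set (D := nodup eq_dec_classic (map (fun e => fst (fst e)) E)).
  assert (HD : NoDup D) by apply NoDup_nodup.
  assert (HDin : forall e, In e E -> In (fst (fst e)) D).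
  { intros e He; apply nodup_In, in_map_iff; eauto. }
  assert (HMD : sum_list M D = 1).
  { rewrite <- (expect_const E 1 HE).
    rewrite (expect_partition E fst D _ HD HDin).
    apply sum_list_ext; intros j; apply expect_ext; intros; lra. }
  assert (E1 : expect E (fun jk => f (fst jk) (snd jk))
    = sum_list (fun j => sum_list (fun k => mu j k * f j k) enumK) D).
  { rewrite (expect_partition E fst D _ HD HDin); apply sum_list_ext; intros j.
    rewrite (expect_partition E snd enumK _ HKnodup) by auto.
    apply sum_list_ext; intros k; unfold mu, expect.
    rewrite <- sum_list_scal_r; apply sum_list_ext; intros [[j' k'] w]; simpl.
    destruct (classic (j' = j)) as [->|N1]; [|rewrite (indic_false _ N1); ring].
    destruct (classic (k' = k)) as [->|N2]; [|rewrite (indic_false _ N2); ring].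
    ring. }
  assert (E2 : expect E (fun jk => sum_list (fun k => cell (kappa (fst jk)) k * f (fst jk) k) enumK)
    = sum_list (fun j => sum_list (fun k => (M j * cell (kappa j) k) * f j k) enumK) D).
  { rewrite (expect_partition E fst D _ HD HDin); apply sum_list_ext; intros j.
    rewrite (sum_list_ext _ (fun k => M j * (cell (kappa j) k * f j k))) by (intros; ring).
    rewrite sum_list_scal; unfold M, expect.
    rewrite <- sum_list_scal_r; apply sum_list_ext; intros [[j' k'] w]; simpl.
    destruct (classic (j' = j)) as [->|N1]; [|rewrite (indic_false _ N1); ring].
    ring. }
  rewrite E1, E2, <- sum_list_minus.
  eapply Rle_trans; [apply sum_list_abs_le|].
  apply Rle_trans with (sum_list (fun j => M j * (INR (length enumK) * delta)) D).
  - apply sum_list_le_in; intros j _; rewrite <- sum_list_minus.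
    eapply Rle_trans; [apply sum_list_abs_le|].
    replace (M j * (INR (length enumK) * delta))
      with (sum_list (fun _ : K => M j * delta) enumK) by (rewrite sum_list_const; ring).
    apply sum_list_le_in; intros k _.
    replace (mu j k * f j k - M j * cell (kappa j) k * f j k)
      with ((mu j k - M j * cell (kappa j) k) * f j k) by ring.
    rewrite Rabs_mult, (Rabs_pos_eq (f j k)) by apply Hf.
    destruct (Hkappa j) as [_ H]; specialize (H k); specialize (Hf j k).
    pose proof (Rabs_pos (mu j k - M j * cell (kappa j) k)); nra.
  - rewrite sum_list_scal_r, HMD; lra.
Qed.

Hypothesis HRs : forall r, In r Rs -> forall k, 0 <= r k <= 1.

(** The weights sit on the entries of the list, not on the indices, so repeated entries need no
    merging. They form a law for every j, even outside the support of E, so that mixing with them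
    always yields a valid strategy. *)
Definition is_kernel (E' : list ((J * K) * R)) (beta : J -> (J * K) * R -> R) : Prop :=
  forall j, (forall e, In e E' -> 0 <= beta j e) /\ sum_list (beta j) E' = 1.

(* A player who knows the index j drawn from E can, by drawing an index from E'
   with law beta j, imitate up to eps one who knows the index drawn from E'. *)
Definition mimics (eps : R) (E E' : list ((J * K) * R)) : Prop :=
  exists beta, is_kernel E' beta /\
    forall f : J -> K -> R, (forall j k, 0 <= f j k <= 1) ->
    Rabs (expect E' (fun jk => f (fst jk) (snd jk))
      - expect E (fun jk => sum_list (fun e => beta (fst jk) e * f (fst (fst e)) (snd jk)) E'))
    <= eps.

(* The kernel sends j to the law of the index of E' conditioned on the cell of j. *)
Lemma mimics_of_cells (E E' : list ((J * K) * R)) kappa kappa' eta :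
  is_fdist E -> is_fdist E' ->
  (forall j, (kappa j < length Rs)%nat) -> (forall j, (kappa' j < length Rs)%nat) ->
  (forall f : J -> K -> R, (forall j k, 0 <= f j k <= 1) ->
    Rabs (expect E (fun jk => f (fst jk) (snd jk))
          - expect E (fun jk => sum_list (fun k => cell (kappa (fst jk)) k * f (fst jk) k) enumK))
    <= INR (length enumK) * delta) ->
  (forall f : J -> K -> R, (forall j k, 0 <= f j k <= 1) ->
    Rabs (expect E' (fun jk => f (fst jk) (snd jk))
          - expect E' (fun jk => sum_list (fun k => cell (kappa' (fst jk)) k * f (fst jk) k) enumK))
    <= INR (length enumK) * delta) ->
  (forall l, (l < length Rs)%nat ->
    Rabs (expect E (fun jk => indic (kappa (fst jk) = l))
          - expect E' (fun jk => indic (kappa' (fst jk) = l))) <= eta) ->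
  mimics (2 * INR (length enumK) * delta + INR (length Rs) * eta * INR (length enumK)) E E'.
Proof.
  intros HE HE' Hka Hka' HQ HQ' Hc.
  set (C := fun l => expect E (fun jk => indic (kappa (fst jk) = l))) in *.
  set (C' := fun l => expect E' (fun jk => indic (kappa' (fst jk) = l))) in *.
  (* A cell to which E' gives mass 0 has no conditional law; E' itself then serves as a default. *)
  set (b := fun l (e : (J * K) * R) =>
    if Req_dec_T (C' l) 0 then snd e else snd e * indic (kappa' (fst (fst e)) = l) / C' l).
  assert (HC' : forall l, 0 <= C' l).
  { intros l; apply expect_bounds with (b := 1); auto; intros; apply indic_bounds. }
  assert (Hb0 : forall l e, In e E' -> 0 <= b l e).
  { intros l e He; unfold b; pose proof (fdist_nonneg _ _ HE' He).
    destruct Req_dec_T; auto. specialize (HC' l).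
    apply Rmult_le_pos; [apply Rmult_le_pos; auto; apply indic_bounds|].
    left; apply Rinv_0_lt_compat; lra. }
  assert (Hb1 : forall l, sum_list (b l) E' = 1).
  { intros l; unfold b; destruct Req_dec_T as [Z|Z].
    - apply HE'.
    - unfold Rdiv; rewrite sum_list_scal_r. fold (expect E' (fun jk => indic (kappa' (fst jk) = l))).
      fold (C' l); now apply Rinv_r. }
  (* Bayes' rule without denominator. It survives [C' l = 0], since then every nonnegative term of
     the sum [C' l] vanishes. *)
  assert (Hbc : forall l e, In e E' -> C' l * b l e = snd e * indic (kappa' (fst (fst e)) = l)).
  { intros l e He; unfold b; destruct Req_dec_T as [Z|Z]; [|field; auto].
    rewrite Z, Rmult_0_l; symmetry.
    assert (Hpos : forall x : (J * K) * R, In x E' -> 0 <= snd x * indic (kappa' (fst (fst x)) = l)).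
    { intros x Hx; apply Rmult_le_pos; [now apply (fdist_nonneg E')|apply indic_bounds]. }
    pose proof (sum_list_term_le _ _ _ Hpos He) as Hle; cbv beta in Hle.
    specialize (Hpos e He).
    unfold C', expect in Z; rewrite Z in Hle; lra. }
  exists (fun j => b (kappa j)); split; [split; auto|].
  intros f Hf.
  (* [phi l i] is the value of index i at the l-th net belief, [psi l] its mean under the imitation
     in cell l. Both sides become averages of [psi], with weights [C'] and [C]: two rounding errors,
     plus one error [eta] per cell. *)
  set (phi := fun l i => sum_list (fun k => cell l k * f i k) enumK).
  set (psi := fun l => sum_list (fun e => b l e * phi l (fst (fst e))) E').
  set (L := seq 0 (length Rs)).
  assert (HL : NoDup L) by apply seq_NoDup.
  assert (Hphi : forall l i, In l L -> 0 <= phi l i <= INR (length enumK)).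
  { intros l i Hl; apply in_seq in Hl.
    assert (Hr : forall k, 0 <= cell l k <= 1) by (apply HRs, nth_In; lia).
    split.
    - apply sum_list_nonneg; intros k _; apply Rmult_le_pos; [apply Hr|apply Hf].
    - replace (INR (length enumK)) with (sum_list (fun _ : K => 1) enumK)
        by (rewrite sum_list_const; ring).
      apply sum_list_le_in; intros k _; specialize (Hr k); specialize (Hf i k); nra. }
  assert (Hpsi : forall l, In l L -> 0 <= psi l <= INR (length enumK)).
  { intros l Hl; split.
    - apply sum_list_nonneg; intros e He; apply Rmult_le_pos; auto. now apply Hphi.
    - replace (INR (length enumK)) with (sum_list (fun e => b l e * INR (length enumK)) E')
        by (rewrite sum_list_scal_r, Hb1; ring).
      apply sum_list_le_in; intros e He; apply Rmult_le_compat_l; auto. now apply Hphi. }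
  assert (T1 : expect E' (fun jk => phi (kappa' (fst jk)) (fst jk))
               = sum_list (fun l => C' l * psi l) L).
  { rewrite (expect_partition E' (fun jk => kappa' (fst jk)) L _ HL)
      by (intros; apply in_seq; simpl; split; [lia|apply Hka']).
    apply sum_list_ext; intros l; unfold psi; rewrite <- sum_list_scal.
    apply sum_list_ext_in; intros e He.
    rewrite <- (Rmult_assoc (C' l)), Hbc by auto.
    destruct (classic (kappa' (fst (fst e)) = l)) as [->|N]; [ring|].
    rewrite (indic_false _ N); ring. }
  assert (T2 : expect E (fun jk => psi (kappa (fst jk))) = sum_list (fun l => C l * psi l) L).
  { rewrite (expect_partition E (fun jk => kappa (fst jk)) L _ HL)
      by (intros; apply in_seq; simpl; split; [lia|apply Hka]).
    apply sum_list_ext; intros l; unfold C, expect; rewrite <- sum_list_scal_r.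
    apply sum_list_ext; intros e.
    destruct (classic (kappa (fst (fst e)) = l)) as [->|N]; [ring|].
    rewrite (indic_false _ N); ring. }
  assert (T3 : Rabs (sum_list (fun l => C' l * psi l) L - sum_list (fun l => C l * psi l) L)
               <= INR (length Rs) * eta * INR (length enumK)).
  { rewrite <- sum_list_minus; eapply Rle_trans; [apply sum_list_abs_le|].
    replace (INR (length Rs) * eta * INR (length enumK))
      with (sum_list (fun _ : nat => eta * INR (length enumK)) L)
      by (rewrite sum_list_const; unfold L; rewrite length_seq; ring).
    apply sum_list_le_in; intros l Hl; pose proof (Hpsi l Hl).
    apply in_seq in Hl; destruct Hl as [_ Hl]; specialize (Hc l Hl).
    change (Rabs (C l - C' l) <= eta) in Hc.
    replace (C' l * psi l - C l * psi l) with (- ((C l - C' l) * psi l)) by ring.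
    rewrite Rabs_Ropp, Rabs_mult, (Rabs_pos_eq (psi l)) by lra.
    rewrite (Rmult_comm eta), Rmult_comm.
    pose proof (Rabs_pos (C l - C' l)); apply Rmult_le_compat; lra. }
  specialize (HQ' f Hf).
  (* Rounding on the side of E is applied to the payoff of the imitator itself. *)
  specialize (HQ (fun j k => sum_list (fun e => b (kappa j) e * f (fst (fst e)) k) E')).
  cbv beta in HQ.
  replace (expect E (fun jk => sum_list (fun k => cell (kappa (fst jk)) k *
      sum_list (fun e => b (kappa (fst jk)) e * f (fst (fst e)) k) E') enumK))
    with (expect E (fun jk => psi (kappa (fst jk)))) in HQ.
  2:{ apply expect_ext; intros jk; unfold psi, phi.
      rewrite (sum_list_ext (fun k => cell (kappa (fst jk)) k * _)
        (fun k => sum_list (fun e => cell (kappa (fst jk)) k *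
           (b (kappa (fst jk)) e * f (fst (fst e)) k)) E'))
        by (intros; now rewrite sum_list_scal).
      rewrite sum_list_swap; apply sum_list_ext; intros e.
      rewrite <- sum_list_scal; apply sum_list_ext; intros; ring. }
  change (Rabs (expect E' (fun jk => f (fst jk) (snd jk))
     - expect E' (fun jk => phi (kappa' (fst jk)) (fst jk))) <= INR (length enumK) * delta) in HQ'.
  rewrite T1 in HQ'; rewrite T2 in HQ.
  assert (HQ0 : forall j k, 0 <= sum_list (fun e => b (kappa j) e * f (fst (fst e)) k) E' <= 1).
  { intros j k; split.
    - apply sum_list_nonneg; intros; apply Rmult_le_pos; auto; apply Hf.
    - rewrite <- (Hb1 (kappa j)); apply sum_list_le_in; intros e He.
      pose proof (Hb0 (kappa j) e He); pose proof (Hf (fst (fst e)) k); nra. }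
  specialize (HQ HQ0).
  apply Rabs_le_inv in HQ, HQ', T3; apply Rabs_le; lra.
Qed.

End Quantization.

(** * Extraction of subsequences *)

Definition unbounded (S : nat -> Prop) : Prop := forall N, exists n, (N <= n)%nat /\ S n.

(** Pigeonhole on strips of height [eta], by induction on their number: either the top strip is
    visited infinitely often, or it is avoided from some rank on and can be removed. *)
Lemma unbounded_refine (u : nat -> R) eta (S : nat -> Prop) :
  0 < eta -> (forall n, 0 <= u n <= 1) -> unbounded S ->
  exists S', unbounded S' /\ (forall n, S' n -> S n) /\
    forall n n', S' n -> S' n' -> Rabs (u n - u n') <= eta.
Proof.
  intros He Hu.
  assert (H : forall q S, unbounded S -> (forall n, S n -> u n <= INR q * eta) ->
    exists S', unbounded S' /\ (forall n, S' n -> S n) /\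
    forall n n', S' n -> S' n' -> Rabs (u n - u n') <= eta).
  { induction q as [|q IH]; intros T HT Hq.
    - exists T; split; [|split]; auto. simpl in Hq; intros n n' Hn Hn'.
      pose proof (Hq n Hn); pose proof (Hq n' Hn'); pose proof (Hu n); pose proof (Hu n').
      apply Rabs_le; lra.
    - destruct (classic (unbounded (fun n => T n /\ INR q * eta < u n))) as [Hi|Hi].
      + exists (fun n => T n /\ INR q * eta < u n); split; [|split]; auto; [tauto|].
        intros n n' [Hn Hn1] [Hn' Hn1']; pose proof (Hq n Hn); pose proof (Hq n' Hn').
        rewrite S_INR in *; apply Rabs_le; lra.
      + apply not_all_ex_not in Hi as [N HN].
        destruct (IH (fun n => T n /\ (N <= n)%nat)) as [S' [H1 [H2 H3]]].
        * intros N0; destruct (HT (max N N0)) as [n [Hn1 Hn2]]; exists n.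
          repeat split; auto; lia.
        * intros n [Hn HNn]; apply Rnot_lt_le; intros Hlt; apply HN; eauto.
        * exists S'; split; [|split]; auto; intros n Hn; now apply H2. }
  intros HS; destruct (INR_unbounded (/ eta)) as [q Hq].
  apply (H q S HS); intros n _; specialize (Hu n).
  apply Rmult_lt_compat_r with (r := eta) in Hq; auto.
  rewrite Rinv_l in Hq; lra.
Qed.

Lemma unbounded_refine_list (u : nat -> nat -> R) eta L (S : nat -> Prop) :
  0 < eta -> (forall l n, 0 <= u l n <= 1) -> unbounded S ->
  exists S', unbounded S' /\ (forall n, S' n -> S n) /\
    forall l, In l L -> forall n n', S' n -> S' n' -> Rabs (u l n - u l n') <= eta.
Proof.
  intros He Hu HS; induction L as [|l L [S1 [H1 [H2 H3]]]].
  - exists S; simpl; tauto.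
  - destruct (unbounded_refine (u l) eta S1) as [S' [H1' [H2' H3']]]; auto.
    exists S'; split; [|split]; auto.
    intros l' [<-|Hl'] n n' Hn Hn'; auto.
Qed.

Lemma mimics_refine {K J : Type} (enumK : list K) (E : nat -> list ((J * K) * R)) eps S :
  NoDup enumK -> (forall k, In k enumK) -> (forall n, is_fdist (E n)) ->
  0 < eps -> unbounded S ->
  exists S', unbounded S' /\ (forall n, S' n -> S n) /\
    forall n n', S' n -> S' n' -> mimics eps (E n) (E n').
Proof.
  intros HK1 HK2 HE He HS.
  set (N := INR (length enumK)).
  assert (HN : 0 <= N) by apply pos_INR.
  (* The two roundings cost [2 * N * delta], at most half of [eps]; [eta] is chosen to keep the cell
     masses within the other half. The added 1 avoids division by 0. *)
  set (delta := eps / (4 * (N + 1))).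
  assert (Hd : 0 < delta) by (apply Rdiv_lt_0_compat; lra).
  destruct (cube_net delta enumK Hd) as [Rs [HR1 HR2]].
  pose proof (fun n => quantize enumK HK1 HK2 delta Rs (fun _ => 0) HR2 (E n) (HE n)) as HQ.
  apply choice in HQ as [kappa HQ].
  set (M := INR (length Rs)).
  assert (HM : 0 <= M) by apply pos_INR.
  set (eta := eps / (2 * (M + 1) * (N + 1))).
  assert (Heta : 0 < eta) by (apply Rdiv_lt_0_compat; nra).
  destruct (unbounded_refine_list
    (fun l n => expect (E n) (fun jk => indic (kappa n (fst jk) = l))) eta (seq 0 (length Rs)) S)
    as [S' [H1 [H2 H3]]]; auto.
  { intros l n; apply expect_bounds; auto; intros; apply indic_bounds. }
  exists S'; split; [|split]; auto.
  intros n n' Hn Hn'.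
  assert (Hm := mimics_of_cells enumK delta Rs (fun _ => 0) HR1 (E n) (E n')
    (kappa n) (kappa n') eta (HE n) (HE n') (proj1 (HQ n)) (proj1 (HQ n'))
    (proj2 (HQ n)) (proj2 (HQ n'))).
  destruct Hm as [beta [Hb1 Hb2]].
  { intros l Hl; apply (H3 l); auto. apply in_seq; lia. }
  exists beta; split; auto; intros f Hf; eapply Rle_trans; [now apply Hb2|].
  fold N M.
  assert (2 * N * delta <= eps / 2).
  { replace (eps / 2) with (2 * (N + 1) * delta) by (unfold delta; field; lra). nra. }
  assert (M * eta * N <= eps / 2).
  { replace (eps / 2) with ((M + 1) * eta * (N + 1)) by (unfold eta; field; lra).
    assert (0 <= M * eta) by nra. nra. }
  lra.
Qed.

(** Nested infinite sets: the i-th and (i+1)-st choices both lie in the i-th set, where all pairs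
    are related at level [delta i]. The rank [N i] is free because the sets are unbounded. *)
Lemma refine_sequence (Rel : R -> nat -> nat -> Prop) (delta : nat -> R) (N : nat -> nat) :
  (forall d S, 0 < d -> unbounded S -> exists S', unbounded S' /\ (forall n, S' n -> S n) /\
    forall n n', S' n -> S' n' -> Rel d n n') ->
  (forall i, 0 < delta i) ->
  exists n : nat -> nat, forall i, (N i <= n i)%nat /\ Rel (delta i) (n i) (n (S i)).
Proof.
  intros HR Hd.
  assert (HR' : forall (i : nat) (S : {S | unbounded S}), exists S' : {S | unbounded S},
    (forall n, proj1_sig S' n -> proj1_sig S n) /\
    forall n n', proj1_sig S' n -> proj1_sig S' n' -> Rel (delta i) n n').
  { intros i [S HS]; destruct (HR (delta i) S (Hd i) HS) as [S' [H1 H2]].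
    now exists (exist _ S' H1). }
  set (next := fun i S => proj1_sig (constructive_indefinite_description _ (HR' i S))).
  assert (Hnext : forall i S, (forall n, proj1_sig (next i S) n -> proj1_sig S n) /\
    forall n n', proj1_sig (next i S) n -> proj1_sig (next i S) n' -> Rel (delta i) n n').
  { intros i S; unfold next; destruct constructive_indefinite_description; auto. }
  assert (HT : unbounded (fun _ => True)) by (intros n; exists n; auto).
  set (T := fix T i := match i with
    | O => next O (exist _ _ HT)
    | S i' => next (S i') (T i') end).
  destruct (choice (fun i n => (N i <= n)%nat /\ proj1_sig (T i) n)) as [n Hn].
  { intros i; apply (proj2_sig (T i)). }
  exists n; intros i; split; [apply Hn|].
  assert (HTi : forall m m', proj1_sig (T i) m -> proj1_sig (T i) m' -> Rel (delta i) m m')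
    by (destruct i; apply Hnext).
  apply HTi; [apply Hn|].
  exact (proj1 (Hnext (S i) (T i)) _ (proj2 (Hn (S i)))).
Qed.

(** * Payoffs of strategies *)

Section Model.
Variables (K A Sig : Type) (enumK : list K)
  (q : K -> A -> list ((Sig * K) * R)) (g : K -> A -> R).
Hypotheses (HKnodup : NoDup enumK) (HKall : forall k : K, In k enumK)
  (HA : inhabited A)
  (Hq : forall k a, is_fdist (q k a)) (Hg : forall k a, 0 <= g k a <= 1).

Local Notation history := (list (A * Sig)).
Local Notation strat := (strategy A Sig).
Local Notation valid := (is_strategy A Sig).
Local Notation law := (layer K A Sig enumK q).
Local Notation stage := (stage_payoff K A Sig enumK q g).

(* Payoff at stage t+1 from initial state k, by recursion on the first stage. *)
Fixpoint pay (sigma : strat) (t : nat) (k : K) : R :=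
  match t with
  | O => expect (sigma []) (g k)
  | S t' => expect (sigma []) (fun a => expect (q k a) (fun sk =>
              pay (fun h => sigma ((a, fst sk) :: h)) t' (snd sk)))
  end.

Lemma pay_ext sigma sigma' t k :
  (forall h, sigma h = sigma' h) -> pay sigma t k = pay sigma' t k.
Proof.
  revert sigma sigma' k; induction t as [|t IH]; intros sigma sigma' k H; simpl.
  - now rewrite H.
  - rewrite H; apply expect_ext; intros a; apply expect_ext; intros sk; auto.
Qed.

Lemma pay_bounds sigma t k : valid sigma -> 0 <= pay sigma t k <= 1.
Proof.
  revert sigma k; induction t as [|t IH]; intros sigma k H; simpl;
    apply expect_bounds; auto.
  intros a; apply expect_bounds; auto. intros sk; apply IH; intros h; apply H.
Qed.

Lemma stage_payoff_expect p sigma n :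
  stage p sigma n = expect (law p sigma n) (fun hk => expect (sigma (fst hk)) (g (snd hk))).
Proof.
  apply sum_list_ext; intros [[h k] w]; simpl; f_equal.
  apply sum_list_ext; intros [a wa]; reflexivity.
Qed.

Lemma law_succ p sigma m F :
  expect (law p sigma (S m)) F =
  expect (law p sigma m) (fun hk => expect (sigma (fst hk)) (fun a =>
    expect (q (snd hk) a) (fun sk => F (fst hk ++ [(a, fst sk)], snd sk)))).
Proof.
  simpl; rewrite expect_flat_map; apply sum_list_ext; intros [[h k] w]; simpl.
  rewrite expect_flat_map; unfold expect at 2.
  rewrite <- sum_list_scal; apply sum_list_ext; intros [a wa]; simpl.
  unfold expect; rewrite sum_list_map, <- Rmult_assoc, <- sum_list_scal.
  apply sum_list_ext; intros [[s k'] wq]; simpl; ring.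
Qed.

Lemma law_length p sigma m e : In e (law p sigma m) -> length (fst (fst e)) = m.
Proof.
  revert e; induction m as [|m IH]; simpl; intros e He.
  - apply in_map_iff in He as [k [<- _]]; reflexivity.
  - apply in_flat_map in He as [[[h k] w] [Hh He]].
    apply in_flat_map in He as [[a wa] [_ He]].
    apply in_map_iff in He as [[[s k'] wq] [<- _]]; simpl.
    rewrite length_app; simpl; rewrite (IH _ Hh : length h = m); lia.
Qed.

Lemma law_ext p sigma sigma' m :
  (forall h, (length h < m)%nat -> sigma h = sigma' h) -> law p sigma m = law p sigma' m.
Proof.
  induction m as [|m IH]; intros H; [reflexivity|]; simpl.
  rewrite IH by (intros; apply H; lia).
  rewrite !flat_map_concat_map; f_equal; apply map_ext_in; intros [[h k] w] Hin.
  rewrite H; [reflexivity|]. apply law_length in Hin; simpl in Hin; lia.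
Qed.

Lemma law_fdist p sigma m : is_prob enumK p -> valid sigma -> is_fdist (law p sigma m).
Proof.
  intros [Hp0 Hp1] Hs; apply fdist_intro.
  - induction m as [|m IH]; simpl; intros e He.
    + apply in_map_iff in He as [k [<- _]]; simpl; auto.
    + apply in_flat_map in He as [[[h k] w] [Hh He]].
      apply in_flat_map in He as [[a wa] [Ha He]].
      apply in_map_iff in He as [[[s k'] wq] [<- Hk]]; simpl.
      specialize (IH _ Hh); pose proof (fdist_nonneg _ _ (Hs h) Ha).
      pose proof (fdist_nonneg _ _ (Hq k a) Hk); simpl in *.
      repeat apply Rmult_le_pos; auto.
  - induction m as [|m IH].
    + unfold expect; simpl; rewrite sum_list_map; transitivity (sum_list p enumK); auto.
      apply sum_list_ext; intros; simpl; ring.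
    + rewrite law_succ; transitivity (expect (law p sigma m) (fun _ => 1)); [|exact IH].
      apply expect_ext; intros hk.
      transitivity (expect (sigma (fst hk)) (fun _ => 1)); [|now apply expect_const].
      apply expect_ext; intros a; now apply expect_const.
Qed.

(** The Markov property. It connects [layer], which appends the last stage to histories, with [pay],
    which peels off the first one. *)
Lemma law_shift p sigma m t :
  expect (law p sigma (m + t)) (fun hk => expect (sigma (fst hk)) (g (snd hk))) =
  expect (law p sigma m) (fun hk => pay (fun h => sigma (fst hk ++ h)) t (snd hk)).
Proof.
  revert m; induction t as [|t IH]; intros m.
  - rewrite Nat.add_0_r; apply expect_ext; intros hk; simpl; now rewrite app_nil_r.
  - rewrite Nat.add_succ_r, <- Nat.add_succ_l, IH, law_succ.
    apply expect_ext; intros hk; simpl; rewrite app_nil_r.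
    apply expect_ext; intros a; apply expect_ext; intros sk.
    apply pay_ext; intros h; now rewrite <- app_assoc.
Qed.

Lemma stage_payoff_shift p sigma m t :
  stage p sigma (m + t) =
  expect (law p sigma m) (fun hk => pay (fun h => sigma (fst hk ++ h)) t (snd hk)).
Proof. rewrite stage_payoff_expect; apply law_shift. Qed.

Lemma stage_payoff_pay p sigma t :
  stage p sigma t = sum_list (fun k => p k * pay sigma t k) enumK.
Proof.
  change t with (0 + t)%nat at 1; rewrite stage_payoff_shift; simpl.
  unfold expect; rewrite sum_list_map; reflexivity.
Qed.

Lemma stage_payoff_bounds p sigma t :
  is_prob enumK p -> valid sigma -> 0 <= stage p sigma t <= 1.
Proof.
  intros Hp Hs; rewrite stage_payoff_expect.
  apply expect_bounds; [now apply law_fdist|]. intros; apply expect_bounds; auto.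
Qed.

Definition dist (p p' : K -> R) : R := sum_list (fun k => Rabs (p k - p' k)) enumK.

Lemma dist_sym p p' : dist p p' = dist p' p.
Proof. apply sum_list_ext; intros; apply Rabs_minus_sym. Qed.

(** Payoffs are linear in p with coefficients in [0,1]. The constant depends neither on the strategy
    nor on the stage, which later gives uniformity over the simplex. *)
Lemma stage_payoff_lipschitz p p' sigma t :
  valid sigma -> stage p sigma t <= stage p' sigma t + dist p p'.
Proof.
  intros Hs; rewrite !stage_payoff_pay; unfold dist.
  rewrite <- sum_list_plus; apply sum_list_le_in; intros k _.
  pose proof (pay_bounds sigma t k Hs); pose proof (Rle_abs (p k - p' k)).
  pose proof (Rabs_pos (p k - p' k)); nra.
Qed.

(** * Mixing strategies *)

Definition mass (l : list (A * R)) (a : A) : R := expect l (fun a' => indic (a' = a)).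

Section Mix.
Context {X : Type}.
Variable I : list X.

(* Posterior weights on I after the action a; the prior is kept if a had
   probability zero. *)
Definition posterior (beta : X -> R) (tau : X -> strat) (a : A) : X -> R :=
  let n := sum_list (fun i => beta i * mass (tau i []) a) I in
  if Req_dec_T n 0 then beta else fun i => beta i * mass (tau i []) a / n.

(* Kuhn's theorem: the behavior strategy that draws i in I with law beta and
   follows tau i. *)
Fixpoint mix (beta : X -> R) (tau : X -> strat) (h : history) {struct h} : list (A * R) :=
  match h with
  | [] => flat_map (fun i => map (fun aw => (fst aw, beta i * snd aw)) (tau i [])) I
  | x :: h' => mix (posterior beta tau (fst x)) (fun i h0 => tau i (x :: h0)) h'
  end.

Definition is_weight (beta : X -> R) : Prop :=
  (forall i, In i I -> 0 <= beta i) /\ sum_list beta I = 1.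

Lemma mass_nonneg l a : is_fdist l -> 0 <= mass l a.
Proof. intros H; apply expect_bounds with (b := 1); auto; intros; apply indic_bounds. Qed.

Lemma posterior_weight beta tau a :
  is_weight beta -> (forall i, valid (tau i)) -> is_weight (posterior beta tau a).
Proof.
  intros [H0 H1] Ht; unfold posterior; set (n := sum_list _ I).
  destruct Req_dec_T as [Z|Z]; [split; auto|].
  assert (Hpos : forall i, In i I -> 0 <= beta i * mass (tau i []) a).
  { intros i Hi; apply Rmult_le_pos; auto. apply mass_nonneg, Ht. }
  assert (0 <= n) by (now apply sum_list_nonneg).
  split.
  - intros i Hi; apply Rmult_le_pos; auto. left; apply Rinv_0_lt_compat; lra.
  - unfold Rdiv; rewrite sum_list_scal_r; fold n; now apply Rinv_r.
Qed.

(** The denominator is cleared so that actions of probability 0 need no separate case. *)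
Lemma posterior_mass beta tau a i :
  is_weight beta -> (forall i, valid (tau i)) -> In i I ->
  sum_list (fun i => beta i * mass (tau i []) a) I * posterior beta tau a i
  = beta i * mass (tau i []) a.
Proof.
  intros [H0 H1] Ht Hi; unfold posterior; set (n := sum_list _ I).
  assert (Hpos : forall i, In i I -> 0 <= beta i * mass (tau i []) a).
  { intros i' Hi'; apply Rmult_le_pos; auto. apply mass_nonneg, Ht. }
  destruct Req_dec_T as [Z|Z]; [|field; auto].
  pose proof (sum_list_term_le _ _ _ Hpos Hi) as Hle; fold n in Hle; cbv beta in Hle.
  specialize (Hpos i Hi); rewrite Z in *; lra.
Qed.

Lemma expect_mix_nil beta tau F :
  expect (mix beta tau []) F = sum_list (fun i => beta i * expect (tau i []) F) I.
Proof.
  simpl; rewrite expect_flat_map; apply sum_list_ext; intros i.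
  unfold expect; rewrite sum_list_map, <- sum_list_scal.
  apply sum_list_ext; intros; simpl; ring.
Qed.

Lemma mix_valid beta tau :
  is_weight beta -> (forall i, valid (tau i)) -> valid (mix beta tau).
Proof.
  intros Hb Ht h; revert beta tau Hb Ht; induction h as [|x h IH]; intros beta tau Hb Ht.
  - apply fdist_intro.
    + simpl; intros e He; apply in_flat_map in He as [i [Hi He]].
      apply in_map_iff in He as [aw [<- Haw]]; simpl.
      apply Rmult_le_pos; [now apply Hb|]. now apply fdist_nonneg with (tau i []); [apply Ht|].
    + rewrite expect_mix_nil; transitivity (sum_list beta I); [|apply Hb].
      apply sum_list_ext; intros i.
      rewrite expect_const by apply Ht; ring.
  - simpl; apply IH.
    + now apply posterior_weight.
    + intros i h'; apply Ht.
Qed.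

(** Mixing looks at its components only along histories no longer than the current one; this makes
    imitation causal. *)
Lemma mix_ext beta tau tau' h :
  (forall i h', (length h' <= length h)%nat -> tau i h' = tau' i h') ->
  mix beta tau h = mix beta tau' h.
Proof.
  revert beta tau tau'; induction h as [|x h IH]; intros beta tau tau' H; simpl.
  - rewrite !flat_map_concat_map; f_equal; apply map_ext; intros i; rewrite H; auto.
  - replace (posterior beta tau' (fst x)) with (posterior beta tau (fst x)).
    + apply IH; intros i h' Hh'; apply H; simpl; lia.
    + unfold posterior.
      assert (E : forall i, mass (tau i []) (fst x) = mass (tau' i []) (fst x))
        by (intros i; rewrite H; [reflexivity|simpl; lia]).
      rewrite (sum_list_ext (fun i => beta i * mass (tau i []) (fst x))
        (fun i => beta i * mass (tau' i []) (fst x))) by (intros; now rewrite E).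
      destruct Req_dec_T; [reflexivity|].
      apply functional_extensionality; intros i; now rewrite E.
Qed.

Lemma expect_mass D (l : list (A * R)) F :
  NoDup D -> (forall aw, In aw l -> In (fst aw) D) ->
  expect l F = sum_list (fun a => mass l a * F a) D.
Proof.
  intros HD Hl; rewrite (expect_partition l (fun a => a) D F HD Hl).
  apply sum_list_ext; intros a; unfold mass, expect.
  rewrite <- sum_list_scal_r; apply sum_list_ext; intros [a' w]; simpl.
  destruct (classic (a' = a)) as [->|N]; [ring|]. rewrite (indic_false _ N); ring.
Qed.

(** Given state and action, the law of the signal does not depend on the component drawn, so
    conditioning on the action alone gives the right posterior. After the first stage the claim is
    the induction hypothesis at the posterior weights. *)
Lemma pay_mix beta tau t k :
  is_weight beta -> (forall i, valid (tau i)) ->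
  pay (mix beta tau) t k = sum_list (fun i => beta i * pay (tau i) t k) I.
Proof.
  revert beta tau k; induction t as [|t IH]; intros beta tau k Hb Ht.
  - apply expect_mix_nil.
  - cbn [pay]; rewrite expect_mix_nil.
    set (Q := fun i a => expect (q k a) (fun sk =>
      pay (fun h => tau i ((a, fst sk) :: h)) t (snd sk))).
    set (D := nodup eq_dec_classic (flat_map (fun i => map fst (tau i [])) I)).
    assert (HD : NoDup D) by apply NoDup_nodup.
    assert (HDin : forall i aw, In i I -> In aw (tau i []) -> In (fst aw) D).
    { intros i aw Hi Haw; apply nodup_In, in_flat_map; exists i; split; auto.
      now apply in_map. }
    assert (E1 : forall a, expect (q k a) (fun sk =>
        pay (fun h => mix beta tau ((a, fst sk) :: h)) t (snd sk))
      = sum_list (fun i => posterior beta tau a i * Q i a) I).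
    { intros a; unfold Q.
      rewrite (sum_list_ext _ (fun i => expect (q k a) (fun sk =>
         posterior beta tau a i * pay (fun h => tau i ((a, fst sk) :: h)) t (snd sk))))
        by (intros; now rewrite expect_scal).
      rewrite <- expect_sum; apply expect_ext; intros sk.
      apply (IH (posterior beta tau a) (fun i h0 => tau i ((a, fst sk) :: h0))).
      - now apply posterior_weight.
      - intros i h; apply Ht. }
    transitivity (sum_list (fun i => beta i *
      sum_list (fun a => mass (tau i []) a * sum_list (fun i' => posterior beta tau a i' * Q i' a) I) D) I).
    { apply sum_list_ext_in; intros i Hi; f_equal.
      rewrite (expect_mass D) by eauto.
      apply sum_list_ext; intros a; now rewrite E1. }
    transitivity (sum_list (fun i => beta i * sum_list (fun a => mass (tau i []) a * Q i a) D) I).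
    2:{ apply sum_list_ext_in; intros i Hi; f_equal.
        symmetry; apply (expect_mass D); eauto. }
    transitivity (sum_list (fun a => sum_list (fun i => beta i * mass (tau i []) a) I *
      sum_list (fun i' => posterior beta tau a i' * Q i' a) I) D).
    { rewrite (sum_list_ext _ (fun i => sum_list (fun a => beta i * (mass (tau i []) a *
        sum_list (fun i' => posterior beta tau a i' * Q i' a) I)) D))
        by (intros; now rewrite sum_list_scal).
      rewrite sum_list_swap; apply sum_list_ext; intros a.
      rewrite <- sum_list_scal_r; apply sum_list_ext; intros; ring. }
    rewrite (sum_list_ext (fun i => beta i * _) (fun i => sum_list (fun a => beta i * (mass (tau i []) a * Q i a)) D))
      by (intros; now rewrite sum_list_scal).
    rewrite (sum_list_swap _ I D); apply sum_list_ext; intros a.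
    rewrite <- sum_list_scal; apply sum_list_ext_in; intros i Hi.
    rewrite <- Rmult_assoc, posterior_mass by auto; ring.
Qed.

End Mix.

Lemma stage_payoff_mix {X} (I : list X) beta tau p t :
  is_weight I beta -> (forall i, valid (tau i)) ->
  stage p (mix I beta tau) t = sum_list (fun i => beta i * stage p (tau i) t) I.
Proof.
  intros Hb Ht; rewrite stage_payoff_pay.
  rewrite (sum_list_ext _ (fun k => sum_list (fun i => p k * (beta i * pay (tau i) t k)) I))
    by (intros; now rewrite pay_mix, sum_list_scal).
  rewrite sum_list_swap; apply sum_list_ext; intros i.
  rewrite stage_payoff_pay, <- sum_list_scal; apply sum_list_ext; intros; ring.
Qed.

(** * Blocks of stages *)

Local Notation index := (nat * history)%type.

(* The law of (t, h_t, k_t) when t is uniform on m, ..., m+n-1; the index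
   (t, h_t) is what the player knows. *)
Definition block (p : K -> R) (sigma : strat) (m n : nat) : list ((index * K) * R) :=
  flat_map (fun t => map (fun e => (((t, fst (fst e)), snd (fst e)), snd e / INR n))
                         (law p sigma t)) (seq m n).

Lemma expect_block p sigma m n F :
  expect (block p sigma m n) F =
  sum_list (fun t => expect (law p sigma t) (fun hk => F ((t, fst hk), snd hk))) (seq m n) / INR n.
Proof.
  unfold block; rewrite expect_flat_map; unfold Rdiv; rewrite <- sum_list_scal_r.
  apply sum_list_ext; intros t; unfold expect; rewrite sum_list_map, <- sum_list_scal_r.
  apply sum_list_ext; intros [[h k] w]; simpl; ring.
Qed.

Lemma block_fdist p sigma m n :
  is_prob enumK p -> valid sigma -> (0 < n)%nat -> is_fdist (block p sigma m n).
Proof.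
  intros Hp Hs Hn; apply lt_0_INR in Hn; apply fdist_intro.
  - intros e He; apply in_flat_map in He as [t [_ He]].
    apply in_map_iff in He as [e' [<- He']]; simpl.
    apply Rmult_le_pos; [|left; now apply Rinv_0_lt_compat].
    eapply fdist_nonneg; [|exact He']; now apply law_fdist.
  - rewrite expect_block.
    rewrite (sum_list_ext _ (fun _ => 1)) by (intros; apply expect_const, law_fdist; auto).
    rewrite sum_list_const, length_seq; field; lra.
Qed.

(** The index is carried along: the continuation receives the updated one, whose law under a block
    is that of the block moved by one stage. *)
Definition follow_one (sigma : strat) (tau : index -> strat) (j : index) : strat :=
  fun h => match h with
           | [] => sigma (snd j)
           | x :: h' => tau (S (fst j), snd j ++ [x]) h'
           end.

Lemma follow_one_valid sigma tau j :
  valid sigma -> (forall j, valid (tau j)) -> valid (follow_one sigma tau j).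
Proof. intros Hs Ht [|x h]; simpl; [apply Hs|apply Ht]. Qed.

Definition avg (p : K -> R) (sigma : strat) (m n : nat) : R :=
  sum_list (stage p sigma) (seq m n) / INR n.

Lemma block_follow_one_0 p sigma tau m n :
  expect (block p sigma m n) (fun jk => pay (follow_one sigma tau (fst jk)) 0 (snd jk))
  = avg p sigma m n.
Proof.
  rewrite expect_block; unfold avg; f_equal; apply sum_list_ext; intros t.
  now rewrite stage_payoff_expect.
Qed.

Lemma sum_list_seq_succ (y : nat -> R) m n :
  sum_list (fun s => y (S s)) (seq m n) = sum_list y (seq m n) + y (m + n)%nat - y m.
Proof.
  revert m; induction n as [|n IH]; intros m; simpl.
  - rewrite Nat.add_0_r; lra.
  - rewrite IH, Nat.add_succ_r; simpl; lra.
Qed.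

(* One more stage of sigma moves the uniform time window by one, which changes
   the law of the index by at most 1/n. *)
Lemma block_follow_one_S p sigma tau m n t :
  is_prob enumK p -> valid sigma -> (forall j, valid (tau j)) -> (0 < n)%nat ->
  expect (block p sigma m n) (fun jk => pay (tau (fst jk)) t (snd jk)) - / INR n
  <= expect (block p sigma m n)
       (fun jk => pay (follow_one sigma tau (fst jk)) (S t) (snd jk)).
Proof.
  intros Hp Hs Ht Hn; apply lt_0_INR in Hn; rewrite !expect_block.
  set (y := fun s => expect (law p sigma s) (fun hk => pay (tau (s, fst hk)) t (snd hk))).
  rewrite (sum_list_ext (fun s => expect (law p sigma s) (fun hk =>
      pay (follow_one sigma tau (fst ((s, fst hk), snd hk))) (S t) (snd ((s, fst hk), snd hk))))
    (fun s => y (S s))) by (intros s; unfold y; rewrite law_succ; reflexivity).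
  rewrite sum_list_seq_succ.
  change (sum_list y (seq m n) / INR n - / INR n
          <= (sum_list y (seq m n) + y (m + n)%nat - y m) / INR n).
  assert (Hy : forall s, 0 <= y s <= 1).
  { intros s; apply expect_bounds; [now apply law_fdist|]. intros; now apply pay_bounds. }
  pose proof (Hy m); pose proof (Hy (m + n)%nat); pose proof (Rinv_0_lt_compat _ Hn).
  unfold Rdiv; nra.
Qed.

(** * Infinite compositions of causal maps *)

Section Limit.
Context {X : Type}.
Variables (F : nat -> (X -> strat) -> X -> strat) (tau0 : X -> strat).
Hypothesis F_causal : forall i tau tau' T,
  (forall x h, (length h < T)%nat -> tau x h = tau' x h) ->
  forall x h, (length h <= T)%nat -> F i tau x h = F i tau' x h.

Fixpoint compose (n i : nat) : X -> strat :=
  match n with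
  | O => tau0
  | S n' => F i (compose n' (S i))
  end.

(** Each application of F settles histories one stage longer, like a contraction for the ultrametric
    of common prefixes. [limit] therefore reads a history at depth one more than its length. *)
Lemma compose_stable n n' i x h :
  (length h < n)%nat -> (length h < n')%nat -> compose n i x h = compose n' i x h.
Proof.
  revert n' i x h; induction n as [|n IH]; intros [|n'] i x h H H'; try lia; simpl.
  apply F_causal with (length h); auto; intros; apply IH; lia.
Qed.

Definition limit (i : nat) (x : X) : strat := fun h => compose (S (length h)) i x h.

Lemma limit_unfold i x h : limit i x h = F i (limit (S i)) x h.
Proof.
  unfold limit at 1; simpl; apply F_causal with (length h); auto.
  intros; apply compose_stable; lia.
Qed.

Lemma limit_valid i x :
  (forall x, valid (tau0 x)) ->
  (forall i tau, (forall x, valid (tau x)) -> forall x, valid (F i tau x)) ->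
  valid (limit i x).
Proof.
  intros H0 HF h; unfold limit; generalize (S (length h)) as n; intros n.
  assert (H : forall n i x, valid (compose n i x)).
  { clear - H0 HF; induction n as [|n IH]; intros i x; simpl; auto. }
  apply H.
Qed.

End Limit.

(* If every block length n admits a block with mean payoff at least c, then the
   laws of these blocks have a subsequence each of which imitates its successor
   up to a summable error: playing one stage of the i-th block and switching to
   an imitation of the (i+1)-st keeps the payoff of all stages above c - eps. *)
Lemma stationary_continuation p c eps :
  is_prob enumK p -> 0 < eps ->
  (forall n, (0 < n)%nat -> exists m sigma, valid sigma /\ c <= avg p sigma m n) ->
  exists m n sigma (tau : index -> strat),
    (0 < n)%nat /\ valid sigma /\ (forall j, valid (tau j)) /\
    forall t, c - eps <= expect (block p sigma m n) (fun jk => pay (tau (fst jk)) t (snd jk)).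
Proof.
  intros Hp He Hc.
  assert (Hc' : forall n, exists ms : nat * strat,
    valid (snd ms) /\ c <= avg p (snd ms) (fst ms) (S n)).
  { intros n; destruct (Hc (S n)) as [m [s H]]; [lia|]. now exists (m, s). }
  apply choice in Hc' as [ms Hms].
  set (E := fun n => block p (snd (ms n)) (fst (ms n)) (S n)).
  assert (HE : forall n, is_fdist (E n)).
  { intros n; apply block_fdist; [auto|apply Hms|lia]. }
  (* Step i loses [delta i] by imitation and at most [delta i] by moving the window; together this
     is the gap between [eps * (1 / 2) ^ i] and its successor. *)
  set (delta := fun i => eps * (1 / 2) ^ i / 4).
  assert (Hd : forall i, 0 < delta i).
  { intros i; unfold delta; assert (0 < (1 / 2) ^ i) by (apply pow_lt; lra); nra. }
  (* The i-th block is taken so long that moving its window costs at most [delta i]. *)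
  assert (HN : forall i, exists N : nat, / delta i < INR N) by (intros; apply INR_unbounded).
  apply choice in HN as [N HN].
  destruct (refine_sequence (fun d n n' => mimics d (E n) (E n')) delta N) as [n Hn]; auto.
  { intros d S Hd' HS; now apply (mimics_refine enumK). }
  assert (HB : forall i, exists beta, is_kernel (E (n (S i))) beta /\
    forall f : index -> K -> R, (forall j k, 0 <= f j k <= 1) ->
    Rabs (expect (E (n (S i))) (fun jk => f (fst jk) (snd jk))
      - expect (E (n i)) (fun jk => sum_list (fun e => beta (fst jk) e * f (fst (fst e)) (snd jk))
                                             (E (n (S i))))) <= delta i).
  { intros i; apply Hn. }
  apply choice in HB as [B HB].
  destruct HA as [a0].
  (* The player adopts the index of the entry drawn and discards its state: the true state stays the
     one in play. *)
  set (Phi := fun i (tau : index -> strat) j =>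
    mix (E (n (S i))) (B i j) (fun e => tau (fst (fst e)))).
  set (F := fun i tau => follow_one (snd (ms (n i))) (Phi i tau)).
  set (P := limit F (fun _ _ => [(a0, 1)])).
  assert (HPhi : forall i tau, (forall j, valid (tau j)) -> forall j, valid (Phi i tau j)).
  { intros i tau Ht j; apply mix_valid; auto. apply HB. }
  assert (HF : forall i tau, (forall j, valid (tau j)) -> forall j, valid (F i tau j)).
  { intros i tau Ht j; apply follow_one_valid; [apply Hms|auto]. }
  assert (HP : forall i j, valid (P i j)).
  { intros i j; apply limit_valid; auto. intros _ h; apply fdist_intro.
    - intros e [<-|[]]; simpl; lra.
    - unfold expect; simpl; lra. }
  assert (HPF : forall i j h, P i j h = F i (P (S i)) j h).
  { intros i j h; apply limit_unfold; clear; intros i tau tau' T H j [|x h] Hh;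
      [reflexivity|]; simpl in *.
    apply mix_ext; intros e h' Hh'; apply H; lia. }
  (* The induction on t holds for all i at once, since stage t+1 seen from block i is stage t seen
     from block i+1. At t = 0 the payoff is the block average. *)
  assert (Main : forall t i, c - eps * (1 / 2) ^ i <=
    expect (E (n i)) (fun jk => pay (P i (fst jk)) t (snd jk))).
  { induction t as [|t IH]; intros i;
      rewrite (expect_ext _ _ (fun jk => pay (F i (P (S i)) (fst jk)) _ (snd jk)))
        by (intros; apply pay_ext, HPF);
      assert (0 < (1 / 2) ^ i) by (apply pow_lt; lra).
    - unfold E, F; rewrite block_follow_one_0.
      pose proof (proj2 (Hms (n i))); nra.
    - pose proof (block_follow_one_S p (snd (ms (n i))) (Phi i (P (S i))) (fst (ms (n i)))
        (S (n i)) t Hp (proj1 (Hms _)) (HPhi _ _ (HP _)) (Nat.lt_0_succ _)) as Hstep.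
      eapply Rle_trans; [|exact Hstep].
      change (block p (snd (ms (n i))) (fst (ms (n i))) (S (n i))) with (E (n i)); clear Hstep.
      rewrite (expect_ext _ _ (fun jk => sum_list (fun e => B i (fst jk) e *
         pay (P (S i) (fst (fst e))) t (snd jk)) (E (n (S i))))).
      2:{ intros jk; unfold Phi; apply pay_mix; auto. apply HB. }
      destruct (HB i) as [_ HBi].
      specialize (HBi (fun j k => pay (P (S i) j) t k) (fun j k => pay_bounds _ _ _ (HP _ _))).
      apply Rabs_le_inv in HBi; cbv beta in HBi.
      specialize (IH (S i)); simpl in IH.
      assert (/ INR (S (n i)) <= delta i).
      { rewrite <- (Rinv_inv (delta i)).
        apply Rinv_le_contravar; [apply Rinv_0_lt_compat; auto|].
        left; eapply Rlt_le_trans; [apply HN|]. apply le_INR.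
        destruct (Hn i); lia. }
      unfold delta in *; lra. }
  exists (fst (ms (n O))), (S (n O)), (snd (ms (n O))), (P O).
  split; [lia|split; [apply Hms|split; [auto|]]].
  intros t; specialize (Main t O); simpl in Main; unfold E in Main; lra.
Qed.

Definition switch (sigma : strat) (tau : index -> strat) (t : nat) : strat :=
  fun h => if (length h <? t)%nat then sigma h else tau (t, firstn t h) (skipn t h).

Lemma switch_valid sigma tau t :
  valid sigma -> (forall j, valid (tau j)) -> valid (switch sigma tau t).
Proof. intros Hs Ht h; unfold switch; destruct Nat.ltb; [apply Hs|apply Ht]. Qed.

Lemma stage_payoff_switch p sigma tau t s :
  stage p (switch sigma tau t) (t + s) =
  expect (law p sigma t) (fun hk => pay (tau (t, fst hk)) s (snd hk)).
Proof.
  rewrite stage_payoff_shift, (law_ext p (switch sigma tau t) sigma).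
  - apply expect_ext_in; intros e He; apply law_length in He; apply pay_ext; intros h.
    unfold switch; rewrite length_app, He.
    destruct (Nat.ltb_spec (t + length h) t); [lia|].
    rewrite <- He, firstn_app, Nat.sub_diag, firstn_all, firstn_O, app_nil_r.
    now rewrite skipn_app, Nat.sub_diag, skipn_all.
  - intros h Hh; unfold switch; destruct (Nat.ltb_spec (length h) t); auto; lia.
Qed.

(** * Evaluations of the payoff *)

Local Notation gam := (gamma K A Sig enumK q g).

Section Gamma.
Variables (theta : nat -> R) (p : K -> R) (sigma : strat).
Hypotheses (Htheta : is_evaluation theta) (Hp : is_prob enumK p) (Hs : valid sigma).

(** Nonnegative terms make [gamma] the supremum of its partial sums; all later estimates use finite
    sums only. *)
Lemma gamma_spec :
  (forall J, psum (fun j => theta j * stage p sigma j) J <= gam theta p sigma) /\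
  (forall B, (forall J, psum (fun j => theta j * stage p sigma j) J <= B) ->
     gam theta p sigma <= B).
Proof.
  assert (H0 : forall i, 0 <= theta i * stage p sigma i).
  { intros i; apply Rmult_le_pos; [apply Htheta|now apply stage_payoff_bounds]. }
  assert (H1 : forall n, psum (fun i => theta i * stage p sigma i) n <= 1).
  { intros n; eapply Rle_trans; [|apply (evaluation_psum_le theta Htheta n)].
    apply psum_le; intros i; destruct (stage_payoff_bounds p sigma i Hp Hs).
    pose proof (proj1 Htheta i); nra. }
  split.
  - apply (infinite_sum_nonneg _ 1 H0 H1).
  - intros B HB; apply (infinite_sum_nonneg _ B H0 HB).
Qed.

Lemma gamma_lipschitz p' :
  is_prob enumK p' -> gam theta p' sigma <= gam theta p sigma + dist p' p.
Proof.
  intros Hp'.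
  assert (H0 : forall i, 0 <= theta i * stage p' sigma i).
  { intros i; apply Rmult_le_pos; [apply Htheta|now apply stage_payoff_bounds]. }
  apply (infinite_sum_nonneg _ (gam theta p sigma + dist p' p) H0); intros J.
  assert (Hd : 0 <= dist p' p) by (apply sum_list_nonneg; intros; apply Rabs_pos).
  apply Rle_trans with (psum (fun j => theta j * stage p sigma j + theta j * dist p' p) J).
  - apply psum_le; intros j; rewrite <- Rmult_plus_distr_l.
    apply Rmult_le_compat_l; [apply Htheta|now apply stage_payoff_lipschitz].
  - unfold psum; rewrite sum_list_plus, sum_list_scal_r.
    pose proof (proj1 gamma_spec J); pose proof (evaluation_psum_le theta Htheta J).
    unfold psum in *; nra.
Qed.

End Gamma.

Lemma avg_bounds p sigma m n :
  is_prob enumK p -> valid sigma -> (0 < n)%nat -> 0 <= avg p sigma m n <= 1.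
Proof.
  intros Hp Hs Hn; apply lt_0_INR in Hn; unfold avg; split.
  - apply Rmult_le_pos; [|left; now apply Rinv_0_lt_compat].
    apply sum_list_nonneg; intros; now apply stage_payoff_bounds.
  - apply Rmult_le_reg_r with (INR n); auto.
    unfold Rdiv; rewrite Rmult_assoc, Rinv_l, Rmult_1_r by lra.
    replace (1 * INR n) with (sum_list (fun _ : nat => 1) (seq m n))
      by (rewrite sum_list_const, length_seq; ring).
    apply sum_list_le_in; intros; now apply stage_payoff_bounds.
Qed.

(* The strategy waits a random time t, uniform on the block, before switching to
   the stationary continuation: the t-th component then loses at most t I(theta). *)
Lemma uniform_guarantee p c eps :
  is_prob enumK p -> 0 < eps ->
  (forall n, (0 < n)%nat -> exists m sigma, valid sigma /\ c <= avg p sigma m n) ->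
  exists sigma (T : nat), valid sigma /\
    forall theta, is_evaluation theta ->
      c - eps - INR T * I_eval theta <= gam theta p sigma.
Proof.
  intros Hp He Hc.
  assert (Hc1 : c <= 1).
  { destruct (Hc 1%nat) as [m [s [Hs Ha]]]; [lia|].
    pose proof (avg_bounds p s m 1 Hp Hs); destruct H; [lia|lra]. }
  destruct (stationary_continuation p c eps Hp He Hc) as [m [n [sigma [tau [Hn [Hs [Ht Hpay]]]]]]].
  assert (Hn' : 0 < INR n) by (now apply lt_0_INR).
  assert (Hw : is_weight (seq m n) (fun _ => / INR n)).
  { split; [intros; left; now apply Rinv_0_lt_compat|].
    rewrite sum_list_const, length_seq; field; lra. }
  assert (Hv : forall t, valid (switch sigma tau t)) by (intros; now apply switch_valid).
  exists (mix (seq m n) (fun _ => / INR n) (switch sigma tau)), (m + n)%nat.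
  split; [now apply mix_valid|].
  intros theta Hth.
  set (T := (m + n)%nat); set (mu := mix _ _ _).
  pose proof (I_eval_nonneg theta Hth) as HI.
  destruct (gamma_spec theta p mu Hth Hp (mix_valid _ _ _ Hw Hv)) as [Hg1 _].
  (* The t stages before the switch pay at least 0 and are dropped. The horizon [T + J] is common to
     all t in the block, so the components can be averaged. *)
  assert (Hpart : forall t J, In t (seq m n) ->
    psum (fun j => theta j * expect (law p sigma t) (fun hk => pay (tau (t, fst hk)) j (snd hk))) J
      - INR T * I_eval theta
    <= psum (fun j => theta j * stage p (switch sigma tau t) j) (T + J)).
  { intros t J Hin; apply in_seq in Hin.
    assert (Hb : forall i, 0 <= stage p (switch sigma tau t) i <= 1)
      by (intros; now apply stage_payoff_bounds).
    apply Rle_trans with (psum (fun j => theta j * stage p (switch sigma tau t) j) (t + J)).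
    2:{ apply psum_growing; [|unfold T; lia].
        intros; apply Rmult_le_pos; [apply Hth|apply Hb]. }
    rewrite psum_split.
    assert (0 <= psum (fun j => theta j * stage p (switch sigma tau t) j) t).
    { apply sum_list_nonneg; intros; apply Rmult_le_pos; [apply Hth|apply Hb]. }
    pose proof (psum_shift_eval_le theta Hth
      (fun j => stage p (switch sigma tau t) (t + j)) t J (fun i => Hb _)) as H2.
    apply Rabs_le_inv in H2; cbv beta in H2.
    assert (INR t * I_eval theta <= INR T * I_eval theta).
    { apply Rmult_le_compat_r; auto. apply le_INR; unfold T; lia. }
    unfold psum in H2 at 2.
    rewrite (sum_list_ext (fun j => theta j * stage p (switch sigma tau t) (t + j))
      (fun j => theta j * expect (law p sigma t) (fun hk => pay (tau (t, fst hk)) j (snd hk))))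
      in H2 by (intros; now rewrite stage_payoff_switch).
    unfold psum at 1; lra. }
  assert (Hsum : forall J, (c - eps) * psum theta J - INR T * I_eval theta <= gam theta p mu).
  { intros J; eapply Rle_trans; [|apply (Hg1 (T + J)%nat)].
    replace (psum (fun j => theta j * stage p mu j) (T + J))
      with (sum_list (fun t => / INR n *
              psum (fun j => theta j * stage p (switch sigma tau t) j) (T + J)) (seq m n)).
    2:{ unfold psum.
        rewrite (sum_list_ext _ (fun t => sum_list (fun j => / INR n *
           (theta j * stage p (switch sigma tau t) j)) (seq 0 (T + J))))
          by (intros; now rewrite sum_list_scal).
        rewrite sum_list_swap; apply sum_list_ext; intros j.
        unfold mu; rewrite stage_payoff_mix, <- sum_list_scal by auto.
        apply sum_list_ext; intros; ring. }
    apply Rle_trans with (sum_list (fun t => / INR n *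
      (psum (fun j => theta j * expect (law p sigma t) (fun hk => pay (tau (t, fst hk)) j (snd hk))) J
      - INR T * I_eval theta)) (seq m n)).
    2:{ apply sum_list_le_in; intros t Hin; apply Rmult_le_compat_l; auto.
        left; now apply Rinv_0_lt_compat. }
    rewrite sum_list_scal, sum_list_minus, sum_list_const, length_seq.
    unfold psum; rewrite sum_list_swap.
    assert (Hj : sum_list (fun j => theta j * (INR n * (c - eps))) (seq 0 J) <=
      sum_list (fun j => sum_list (fun t => theta j * expect (law p sigma t)
        (fun hk => pay (tau (t, fst hk)) j (snd hk))) (seq m n)) (seq 0 J)).
    { apply sum_list_le_in; intros j _; rewrite sum_list_scal.
      apply Rmult_le_compat_l; [apply Hth|].
      specialize (Hpay j); rewrite expect_block in Hpay; simpl in Hpay.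
      apply Rmult_le_compat_l with (r := INR n) in Hpay; [|lra].
      eapply Rle_trans; [exact Hpay|]. apply Req_le; field; lra. }
    rewrite sum_list_scal_r in Hj.
    apply Rmult_le_reg_l with (INR n); auto.
    rewrite <- (Rmult_assoc (INR n) (/ INR n)), Rinv_r by lra. lra. }
  apply Rle_trans with (c - eps - INR T * I_eval theta); [lra|].
  (* J is chosen with the partial mass of [theta] close to 1; since [c <= 1], the missing mass costs
     no more than itself. *)
  apply Rnot_lt_le; intros Hlt.
  destruct (evaluation_psum_cv theta Hth (c - eps - INR T * I_eval theta - gam theta p mu))
    as [J HJ]; [lra|].
  specialize (Hsum J); pose proof (evaluation_psum_le theta Hth J).
  assert (c - eps - (1 - psum theta J) <= (c - eps) * psum theta J) by nra.
  lra.
Qed.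

(** * The value *)

(** An infimum of suprema, stated through approximations: the first half bounds every strategy from
    above, the second feeds [uniform_guarantee]. *)
Definition is_value (p : K -> R) (v : R) : Prop :=
  (forall eps, 0 < eps -> exists n, (0 < n)%nat /\
     forall m sigma, valid sigma -> avg p sigma m n <= v + eps) /\
  (forall eps n, 0 < eps -> (0 < n)%nat -> exists m sigma, valid sigma /\ v - eps <= avg p sigma m n).

Lemma some_valid : exists sigma, valid sigma.
Proof.
  destruct HA as [a]; exists (fun _ => [(a, 1)]); intros h; apply fdist_intro.
  - intros e [<-|[]]; simpl; lra.
  - unfold expect; simpl; lra.
Qed.

(* v = inf over n of the supremum over m and sigma of the mean payoff of the
   stages m+1, ..., m+n *)
Lemma is_value_exists p : is_prob enumK p -> exists v, is_value p v.
Proof.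
  intros Hp.
  (* [completeness] yields least upper bounds, so the infimum is reached through opposites. *)
  set (U := fun x => exists n, (0 < n)%nat /\
    forall m sigma, valid sigma -> avg p sigma m n <= - x).
  destruct (completeness U) as [L [HL1 HL2]].
  - exists 0; intros x [n [Hn Hx]]; destruct some_valid as [s Hs].
    specialize (Hx O s Hs); pose proof (avg_bounds p s 0 n Hp Hs Hn); lra.
  - exists (-1), 1%nat; split; [lia|]; intros m s Hs.
    destruct (avg_bounds p s m 1 Hp Hs); [lia|lra].
  - exists (- L); split.
    + intros eps He; apply NNPP; intros HN.
      assert (HU : is_upper_bound U (L - eps)).
      { intros x [n [Hn Hx]]; apply Rnot_lt_le; intros Hlt; apply HN.
        exists n; split; auto; intros m s Hs; specialize (Hx m s Hs); lra. }
      apply HL2 in HU; lra.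
    + intros eps n He Hn; apply NNPP; intros HN.
      assert (HU : U (L + eps)).
      { exists n; split; auto; intros m s Hs; apply Rnot_lt_le; intros Hlt; apply HN.
        exists m, s; split; auto; lra. }
      apply HL1 in HU; lra.
Qed.

Lemma is_value_lipschitz p p' v v' :
  is_value p v -> is_value p' v' -> v <= v' + dist p p'.
Proof.
  intros [_ H2] [H1' _]; apply le_epsilon; intros eps He.
  destruct (H1' (eps / 2)) as [n [Hn Hn']]; [lra|].
  destruct (H2 (eps / 2) n) as [m [s [Hs Hm]]]; auto; [lra|].
  specialize (Hn' m s Hs); apply lt_0_INR in Hn.
  assert (avg p s m n <= avg p' s m n + dist p p'); [|lra].
  unfold avg; apply Rmult_le_reg_r with (INR n); auto.
  unfold Rdiv; rewrite Rmult_plus_distr_r, !Rmult_assoc, Rinv_l, !Rmult_1_r by lra.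
  replace (dist p p' * INR n) with (sum_list (fun _ : nat => dist p p') (seq m n))
    by (rewrite sum_list_const, length_seq; ring).
  rewrite <- sum_list_plus; apply sum_list_le_in; intros; now apply stage_payoff_lipschitz.
Qed.

(** The bound on all strategies stands for the bound on [v_theta], whose epsilon-chosen supremum is
    handled only at the end. *)
Definition guarantees (p : K -> R) (v eps alpha : R) (sigma : strat) : Prop :=
  valid sigma /\ forall theta, is_evaluation theta -> I_eval theta <= alpha ->
    (forall sigma', valid sigma' -> gam theta p sigma' <= v + eps) /\
    v - eps <= gam theta p sigma.

Lemma guarantees_exists p v eps :
  is_prob enumK p -> is_value p v -> 0 < eps ->
  exists alpha sigma, 0 < alpha /\ guarantees p v eps alpha sigma.
Proof.
  intros Hp [Hv1 Hv2] He.
  destruct (Hv1 (eps / 2)) as [n [Hn Hup]]; [lra|].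
  destruct (uniform_guarantee p (v - eps / 3) (eps / 3) Hp) as [sigma [T [Hs Hlow]]]; [lra| |].
  { intros n' Hn'; apply Hv2; auto; lra. }
  assert (Hn' : 0 < INR n) by (now apply lt_0_INR).
  pose proof (pos_INR T) as HT.
  (* [a1] makes the window error [2 * INR n * I_eval theta] at most eps/2. [a2] makes the entry cost
     at most eps/3, next to eps/3 for the choice of c and eps/3 for the continuation. *)
  set (a1 := eps / (4 * INR n)); set (a2 := eps / (3 * (INR T + 1))).
  assert (Ha1 : 0 < a1) by (apply Rdiv_lt_0_compat; lra).
  assert (Ha2 : 0 < a2) by (apply Rdiv_lt_0_compat; lra).
  exists (Rmin a1 a2), sigma; split; [now apply Rmin_glb_lt|].
  split; auto; intros theta Hth HI.
  pose proof (I_eval_nonneg theta Hth).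
  assert (HI1 : I_eval theta <= a1) by (eapply Rle_trans; [exact HI|apply Rmin_l]).
  assert (HI2 : I_eval theta <= a2) by (eapply Rle_trans; [exact HI|apply Rmin_r]).
  split.
  - intros s Hs'; apply (gamma_spec theta p s Hth Hp Hs'); intros J.
    eapply Rle_trans; [apply (eval_le_window theta Hth (stage p s) n (v + eps / 2) J)|]; auto.
    + intros; now apply stage_payoff_bounds.
    + intros m; specialize (Hup m s Hs'); unfold avg in Hup.
      apply Rmult_le_compat_l with (r := INR n) in Hup; [|lra].
      replace (INR n * (sum_list (stage p s) (seq m n) / INR n))
        with (sum_list (stage p s) (seq m n)) in Hup by (field; lra); auto.
    + assert (2 * INR n * I_eval theta <= 2 * INR n * a1) by (apply Rmult_le_compat_l; lra).
      replace (2 * INR n * a1) with (eps / 2) in H0 by (unfold a1; field; lra); lra.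
  - specialize (Hlow theta Hth).
    assert (INR T * I_eval theta <= (INR T + 1) * a2) by (apply Rmult_le_compat; lra).
    replace ((INR T + 1) * a2) with (eps / 3) in H0 by (unfold a2; field; lra); lra.
Qed.

Lemma guarantees_antitone p v eps alpha alpha' sigma :
  alpha' <= alpha -> guarantees p v eps alpha sigma -> guarantees p v eps alpha' sigma.
Proof. intros Ha [Hs H]; split; auto; intros theta Hth HI; apply H; auto; lra. Qed.

(** One distance pays for moving the value, the other for moving the payoff of a fixed strategy. *)
Lemma guarantees_lipschitz p p' v v' eps alpha sigma :
  is_prob enumK p -> is_prob enumK p' -> is_value p v -> is_value p' v' ->
  guarantees p v eps alpha sigma ->
  guarantees p' v' (eps + 2 * dist p p') alpha sigma.
Proof.
  intros Hp Hp' Hv Hv' [Hs H]; split; auto; intros theta Hth HI.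
  destruct (H theta Hth HI) as [H1 H2].
  pose proof (is_value_lipschitz p p' v v' Hv Hv').
  pose proof (is_value_lipschitz p' p v' v Hv' Hv).
  rewrite (dist_sym p' p) in *; split.
  - intros s Hs'; specialize (H1 s Hs').
    pose proof (gamma_lipschitz theta p s Hth Hp Hs' p' Hp'); rewrite (dist_sym p' p) in *; lra.
  - pose proof (gamma_lipschitz theta p' sigma Hth Hp' Hs p Hp); lra.
Qed.

Lemma guarantees_uniform (v : (K -> R) -> R) eps :
  (forall p, is_prob enumK p -> is_value p (v p)) -> 0 < eps ->
  exists alpha, 0 < alpha /\
    forall p, is_prob enumK p -> exists sigma, guarantees p (v p) eps alpha sigma.
Proof.
  intros Hv He.
  set (N := INR (length enumK)); assert (HN : 0 <= N) by apply pos_INR.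
  set (delta := eps / (8 * (N + 1))).
  assert (Hd : 0 < delta) by (apply Rdiv_lt_0_compat; lra).
  destruct (cube_net delta enumK Hd) as [Rs [_ Hnet]].
  set (near := fun (p r : K -> R) => is_prob enumK p /\
    forall k, In k enumK -> Rabs (p k - r k) <= delta).
  (* Net points may lie off the simplex, so each one that has a probability nearby is represented by
     such a probability; [alpha] is a minimum over finitely many. Two probabilities near the same
     net point are at distance at most [2 * N * delta]. *)
  assert (Hal : exists alpha, 0 < alpha /\ forall r, In r Rs -> (exists p, near p r) ->
    exists p sigma, near p r /\ guarantees p (v p) (eps / 2) alpha sigma).
  { clear Hnet; induction Rs as [|r Rs [alpha [Ha IH]]].
    - exists 1; split; [lra|]; intros r [].
    - destruct (classic (exists p, near p r)) as [[p Hpr]|Hno].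
      + destruct (guarantees_exists p (v p) (eps / 2)) as [alpha' [s [Ha' Hs]]];
          [apply Hpr|apply Hv, Hpr|lra|].
        exists (Rmin alpha alpha'); split; [now apply Rmin_glb_lt|].
        intros r' [<-|Hr'] Hex.
        * exists p, s; split; auto. eapply guarantees_antitone; [apply Rmin_r|exact Hs].
        * destruct (IH r' Hr' Hex) as [p' [s' [H1 H2]]]; exists p', s'; split; auto.
          eapply guarantees_antitone; [apply Rmin_l|exact H2].
      + exists alpha; split; auto; intros r' [<-|Hr'] Hex; [tauto|auto]. }
  destruct Hal as [alpha [Ha Hal]]; exists alpha; split; auto.
  intros p Hp.
  assert (Hp1 : forall k, 0 <= p k <= 1).
  { intros k; destruct Hp as [H0 H1]; split; auto. rewrite <- H1.
    apply sum_list_term_le; auto. }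
  destruct (Hnet p Hp1) as [r [Hr Hpr]].
  destruct (Hal r Hr) as [p' [s [[Hp' Hp'r] Hs]]]; [exists p; split; auto|].
  exists s.
  pose proof (guarantees_lipschitz p' p (v p') (v p) (eps / 2) alpha s Hp' Hp (Hv _ Hp') (Hv _ Hp) Hs)
    as [Hval Hgu].
  assert (Hdist : 2 * dist p' p <= eps / 2).
  { assert (dist p' p <= N * (2 * delta)).
    { unfold N; rewrite <- (sum_list_const (2 * delta) enumK).
      apply sum_list_le_in; intros k Hk.
      specialize (Hpr k Hk); specialize (Hp'r k Hk).
      apply Rabs_le_inv in Hpr, Hp'r; apply Rabs_le; lra. }
    replace (eps / 2) with (2 * ((N + 1) * (2 * delta))) by (unfold delta; field; lra).
    nra. }
  split; auto; intros theta Hth HI; destruct (Hgu theta Hth HI) as [G1 G2]; split.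
  - intros s' Hs'; specialize (G1 s' Hs'); lra.
  - lra.
Qed.

(** The supremum chosen by epsilon is genuine once the payoffs are bounded and some strategy
    exists. *)
Lemma v_theta_lub theta p B :
  (forall sigma, valid sigma -> gam theta p sigma <= B) ->
  is_lub (fun x => exists sigma, valid sigma /\ x = gam theta p sigma)
    (v_theta K A Sig enumK q g theta p).
Proof.
  intros HB; unfold v_theta, sup_R; apply epsilon_spec.
  destruct (completeness (fun x => exists sigma, valid sigma /\ x = gam theta p sigma))
    as [L HL].
  - exists B; intros x [s [Hs ->]]; auto.
  - destruct some_valid as [s Hs]; exists (gam theta p s), s; auto.
  - now exists L.
Qed.

End Model.

Theorem theorem5
  (K A Sig : Type) (enumK : list K)
  (HKnodup : NoDup enumK) (HKall : forall k : K, In k enumK)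
  (HA : inhabited A) (HS : inhabited Sig)
  (q : K -> A -> list ((Sig * K) * R))
  (Hq : forall k a, is_fdist (q k a))
  (g : K -> A -> R) (Hg : forall k a, 0 <= g k a <= 1) :
  exists vstar : (K -> R) -> R,
    forall eps : R, eps > 0 ->
      exists alpha : R, alpha > 0 /\
      exists sigma : (K -> R) -> strategy A Sig,
        (forall p, is_prob enumK p -> is_strategy A Sig (sigma p)) /\
        forall theta : nat -> R,
          is_evaluation theta -> I_eval theta <= alpha ->
          forall p : K -> R, is_prob enumK p ->
            Rabs (v_theta K A Sig enumK q g theta p - vstar p) <= eps /\
            gamma K A Sig enumK q g theta p (sigma p) >= vstar p - eps.
Proof.
  assert (Hv : forall p, exists v, is_prob enumK p -> is_value K A Sig enumK q g p v).
  { intros p; destruct (classic (is_prob enumK p)) as [Hp|Hp]; [|exists 0; tauto].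
    destruct (is_value_exists K A Sig enumK q g HA Hq Hg p Hp) as [v H]; eauto. }
  apply choice in Hv as [v Hv]; exists v; intros eps He.
  destruct (guarantees_uniform K A Sig enumK q g HKnodup HKall HA Hq Hg v eps Hv He)
    as [alpha [Ha Hgu]].
  exists alpha; split; auto.
  assert (Hsig : forall p, exists sigma, is_prob enumK p ->
    guarantees K A Sig enumK q g p (v p) eps alpha sigma).
  { intros p; destruct (classic (is_prob enumK p)) as [Hp|Hp].
    - destruct (Hgu p Hp) as [s Hs]; eauto.
    - exists (fun _ => []); tauto. }
  apply choice in Hsig as [sigma Hsig]; exists sigma; split.
  - intros p Hp; apply (Hsig p Hp).
  - intros theta Hth HI p Hp; destruct (Hsig p Hp) as [Hs H].
    destruct (H theta Hth HI) as [H1 H2].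
    destruct (v_theta_lub K A Sig enumK q g HA theta p _ H1) as [L1 L2].
    split; [|lra].
    assert (v_theta K A Sig enumK q g theta p <= v p + eps).
    { apply L2; intros x [s [Hs' ->]]; auto. }
    assert (gamma K A Sig enumK q g theta p (sigma p) <= v_theta K A Sig enumK q g theta p).
    { apply L1; eauto. }
    apply Rabs_le; lra.
Qed.
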